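(* Let $T$ be a positive Riesz operator on an order complete Banach lattice $E$. Then $\mathcal P_E(T)=\mathcal P_A(T)$.
   Context: A bounded operator $T$ on a Banach space $X$ is a Riesz operator if its image $\pi(T)$ in the Calkin algebra $\mathcal B(X)/\mathcal K(X)$ (bounded operators modulo compact operators) is quasinilpotent, i.e. $\lim_n\|\pi(T)^n\|^{1/n}=0$ (for a real Banach lattice, spectral notions are understood via the complexification). $\mathcal L_r(E)$ is the order complete vector lattice of regular operators on $E$ (differences of positive operators). $\mathrm{Orth}(E)$ is the set of orthomorphisms of $E$ (order bounded operators leaving every band of $E$ invariant); it is a projection band in $\mathcal L_r(E)$, namely the band generated by the identity operator. $\mathcal P_E$ denotes the band projection of $\mathcal L_r(E)$ onto $\mathrm{Orth}(E)$; $\mathcal P_E(T)$ is called the diagonal of $T$. For a band $B$ of $E$ with band projection $P_B$, $\mathcal P_B(T)$ denotes the diagonal, in the order complete vector lattice $B$, of the compression $P_BTP_B$, regarded as an operator on $E$ that is zero on $B^d$. An atom of $E$ is a non-zero positive vector $a$ such that $0\le x,y\le a$ and $x\perp y$ imply $x=0$ or $y=0$. $A$ denotes the atomic part of $E$, i.e. the band generated by all atoms of $E$; $\mathcal P_A(T)$ is called the atomic diagonal of $T$. *)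

(* Defs.v *)
From HB Require Import structures.
From mathcomp Require Import all_boot all_order all_algebra.
From mathcomp Require Import complex ring.
From mathcomp Require Import boolp classical_sets functions reals topology.
From mathcomp Require Import normedtype sequences exp.

Set Implicit Arguments.
Unset Strict Implicit.
Unset Printing Implicit Defensive.

Import Order.TTheory GRing.Theory Num.Theory.
Import numFieldNormedType.Exports.

Local Open Scope classical_set_scope.
Local Open Scope ring_scope.

(* A structure inheriting from both [Order.POrder] and [Num.NormedZmodule], or
   from both [Order.Lattice] and [GRing.Zmodule], has to be declared before
   [Num.NumDomain] or [Num.RealDomain]. Hence the lattice operations are fields of
   [isVectorLattice] rather than those of [Order.Lattice], and below the norm of
   a Banach lattice is a plain function [vnorm], whose normed space structure
   is carried by the alias [normed_space]. *)
HB.mixin Record isVectorLattice (R : realType) (V : Type)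
    & Num.POrderedZmodule V & GRing.Lmodule R V := {
  vlerD2r : forall z x y : V, x <= y -> x + z <= y + z;
  vscaler_ge0 : forall (a : R) (x : V), 0 <= a -> 0 <= x -> 0 <= a *: x;
  vjoin : V -> V -> V;
  vmeet : V -> V -> V;
  vjoin_le : forall x y z : V, (vjoin x y <= z) = (x <= z) && (y <= z);
  le_vmeet : forall x y z : V, (z <= vmeet x y) = (z <= x) && (z <= y)
}.

#[short(type="vectorLatticeType")]
HB.structure Definition VectorLattice (R : realType) :=
  {V of Num.POrderedZmodule V & GRing.Lmodule R V & isVectorLattice R V}.

HB.factory Record Lmodule_hasPositivePart (R : realType) (V : Type)
    & Num.POrderedZmodule V & GRing.Lmodule R V := {
  vlerD2r : forall z x y : V, x <= y -> x + z <= y + z;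
  vscaler_ge0 : forall (a : R) (x : V), 0 <= a -> 0 <= x -> 0 <= a *: x;
  pospart : V -> V;
  pospart_le : forall x y : V, (pospart x <= y) = (x <= y) && (0 <= y)
}.

HB.builders Context (R : realType) (V : Type)
  & Lmodule_hasPositivePart R V.

Let lerD2rE (z x y : V) : (x + z <= y + z) = (x <= y).
Proof.
by apply/idP/idP => [/(vlerD2r (- z))|/(vlerD2r z)//]; rewrite !addrK.
Qed.

Let vjoin (x y : V) : V := y + pospart (x - y).
Let vmeet (x y : V) : V := x - pospart (x - y).

Let vjoin_le (x y z : V) : (vjoin x y <= z) = (x <= z) && (y <= z).
Proof.
rewrite /vjoin -(lerD2rE (- y)) addrC addKr pospart_le lerD2rE.
by rewrite -[X in _ && X](lerD2rE y) add0r subrK.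
Qed.

Let le_vmeet (x y z : V) : (z <= vmeet x y) = (z <= x) && (z <= y).
Proof.
rewrite /vmeet -(lerD2rE (pospart (x - y) - z)) addrCA subrr addr0.
rewrite [X in _ <= X]addrA subrK pospart_le.
rewrite -[X in X && _](lerD2rE (z + y - x)) -[X in _ && X](lerD2rE z).
rewrite add0r subrK andbC; congr (_ && (_ <= _)).
  by rewrite addrA [z + y]addrC addrA subrK addrAC subrr add0r.
by rewrite addrA [x - z + _]addrA subrK addrAC subrr add0r.
Qed.

HB.instance Definition _ := isVectorLattice.Build R V
  vlerD2r vscaler_ge0 vjoin_le le_vmeet.

HB.end.

HB.mixin Record isOrderComplete (R : realType) (V : Type)
    & VectorLattice R V := {
  order_complete : forall A : set V,
    A !=set0 -> has_ubound A -> supremums A !=set0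
}.

#[short(type="ocVectorLatticeType")]
HB.structure Definition OCVectorLattice (R : realType) :=
  {V of VectorLattice R V & isOrderComplete R V}.

Section VectorLatticeDefs.
Context {R : realType} {V : vectorLatticeType R}.
Implicit Types (x y : V) (B : set V).

Definition vpos x : V := vjoin x 0.

Definition vabs x : V := vjoin x (- x).

Definition vdisjoint x y := vmeet (vabs x) (vabs y) = 0.

Definition disjoint_compl B : set V :=
  [set x | forall y, B y -> vdisjoint x y].

Definition is_ideal B :=
  [/\ B 0, forall (a : R) x y, B x -> B y -> B (a *: x + y) &
      forall x y, B y -> vabs x <= vabs y -> B x].

Definition is_band B :=
  is_ideal B /\ forall A s, A `<=` B -> supremums A s -> B s.

(* If V = B + B^d, the component of x in B; it is unique since B and B^d meet
   in 0 only. The default 0 is used only if B is not a projection band. *)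
Definition band_proj B x : V :=
  xget 0 [set b | B b /\ disjoint_compl B (x - b)].

Definition is_atom (a : V) :=
  [/\ a != 0, 0 <= a &
      forall x y, 0 <= x -> x <= a -> 0 <= y -> y <= a -> vdisjoint x y ->
        x = 0 \/ y = 0].

Definition generated_band (S : set V) : set V :=
  [set x | forall B, is_band B -> S `<=` B -> B x].

Lemma generated_band_is_band (S : set V) : is_band (generated_band S).
Proof.
split; last first.
  move=> A s AS sA B Bb SB; apply: (Bb.2 A) => // x /AS; exact.
split=> [B [[]]//|a x y Bx By B Bb SB|x y By xy B Bb SB].
- by case: (Bb.1) => _ + _; apply; [exact: Bx|exact: By].
- by case: (Bb.1) => _ _; apply; [exact: By|].
Qed.

End VectorLatticeDefs.

Record band (R : realType) (V : vectorLatticeType R) := Band {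
  band_set :> set V;
  bandP : is_band band_set
}.

Definition atomic_part (R : realType) (V : vectorLatticeType R) : band V :=
  Band (generated_band_is_band [set a : V | is_atom a]).

Section VectorLatticeTheory.
Context {R : realType} {V : vectorLatticeType R}.
Implicit Types (x y z : V) (a : R).

Lemma vlerD x y z t : x <= y -> z <= t -> x + z <= y + t.
Proof.
move=> xy zt; apply: (le_trans (vlerD2r z _ _ xy)).
by rewrite ![y + _]addrC vlerD2r.
Qed.

Lemma vsubr_ge0 x y : (0 <= y - x) = (x <= y).
Proof.
apply/idP/idP => [/(vlerD2r x)|/(vlerD2r (- x))].
  by rewrite add0r subrK.
by rewrite subrr.
Qed.

Lemma vlerD2rE z x y : (x + z <= y + z) = (x <= y).
Proof.
by rewrite -[LHS]vsubr_ge0 opprD addrACA subrr addr0 vsubr_ge0.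
Qed.

Lemma vlerBlDr x y z : (x - y <= z) = (x <= z + y).
Proof. by rewrite -[LHS](vlerD2rE y) subrK. Qed.

Lemma vlerBrDr x y z : (x <= y - z) = (x + z <= y).
Proof. by rewrite -[LHS](vlerD2rE z) subrK. Qed.

Lemma vlerN2 x y : (- x <= - y) = (y <= x).
Proof. by rewrite -[LHS]vsubr_ge0 opprK addrC vsubr_ge0. Qed.

Lemma vaddr_ge0 x y : 0 <= x -> 0 <= y -> 0 <= x + y.
Proof. by move=> x0 y0; rewrite -[0]addr0 vlerD. Qed.

Lemma vlerDl x y : 0 <= y -> x <= x + y.
Proof. by move=> y0; rewrite -[X in X <= _]addr0 vlerD. Qed.

Lemma vlerDr x y : 0 <= y -> x <= y + x.
Proof. by rewrite addrC; exact: vlerDl. Qed.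

Lemma vlerZ a x y : 0 <= a -> x <= y -> a *: x <= a *: y.
Proof.
by move=> a0 xy; rewrite -vsubr_ge0 -scalerBr vscaler_ge0// vsubr_ge0.
Qed.

Lemma vlerZl a b x : a <= b -> 0 <= x -> a *: x <= b *: x.
Proof.
by move=> ab x0; rewrite -vsubr_ge0 -scalerBl vscaler_ge0// subr_ge0.
Qed.

Lemma vjoin_lel x y : x <= vjoin x y.
Proof. by have := lexx (vjoin x y); rewrite vjoin_le => /andP[]. Qed.

Lemma vjoin_ler x y : y <= vjoin x y.
Proof. by have := lexx (vjoin x y); rewrite vjoin_le => /andP[]. Qed.

Lemma vmeet_lel x y : vmeet x y <= x.
Proof. by have := lexx (vmeet x y); rewrite le_vmeet => /andP[]. Qed.

Lemma vmeet_ler x y : vmeet x y <= y.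
Proof. by have := lexx (vmeet x y); rewrite le_vmeet => /andP[]. Qed.

Lemma vpos_ge0 x : 0 <= vpos x. Proof. exact: vjoin_ler. Qed.

Lemma vpos_ge x : x <= vpos x. Proof. exact: vjoin_lel. Qed.

Lemma vposN x : vpos (- x) = vpos x - x.
Proof.
apply/le_anti/andP; split.
  by rewrite vjoin_le vsubr_ge0 vpos_ge andbT vlerBrDr addNr vpos_ge0.
rewrite vlerBlDr vjoin_le vlerDr ?vpos_ge0//=.
by rewrite -(addNr x) vlerD2r// vpos_ge.
Qed.

Lemma vposB x : vpos x - vpos (- x) = x.
Proof. by rewrite vposN opprB addrC subrK. Qed.

Lemma vabs_le x y : (vabs x <= y) = (x <= y) && (- x <= y).
Proof. exact: vjoin_le. Qed.

Lemma vabs_ge x : x <= vabs x. Proof. exact: vjoin_lel. Qed.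

Lemma vabs_geN x : - x <= vabs x. Proof. exact: vjoin_ler. Qed.

Lemma vabs_ge0 x : 0 <= vabs x.
Proof.
have -> : vabs x = 2^-1 *: (vabs x + vabs x).
  by rewrite -mulr2n -(scaler_nat 2 (vabs x)) scalerA mulVf ?pnatr_eq0// scale1r.
rewrite vscaler_ge0 ?invr_ge0 ?ler0n// -(subrr x).
by rewrite vlerD ?vabs_ge ?vabs_geN.
Qed.

Lemma vabs_id x : 0 <= x -> vabs x = x.
Proof.
move=> x0; apply/le_anti; rewrite vabs_ge vabs_le lexx /= andbT.
by rewrite (le_trans _ x0)// -oppr0 vlerN2.
Qed.

Lemma vabsN x : vabs (- x) = vabs x.
Proof.
by apply/le_anti; rewrite !vabs_le opprK vabs_ge vabs_geN vabs_ge -[x in x <= _]opprK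
  vabs_geN.
Qed.

Lemma vabsD x y : vabs (x + y) <= vabs x + vabs y.
Proof. by rewrite vabs_le opprD !vlerD ?vabs_ge ?vabs_geN. Qed.

Lemma vabsZ a x : vabs (a *: x) <= `|a| *: vabs x.
Proof.
have [a0|/ltW a0] := leP 0 a.
  by rewrite ger0_norm// vabs_le -scalerN !vlerZ ?vabs_ge ?vabs_geN.
rewrite ler0_norm// vabs_le -scaleNr -[a *: x]opprK -scaleNr -scalerN.
by rewrite !vlerZ ?vabs_ge ?vabs_geN// oppr_ge0.
Qed.

Lemma vabs_eq0 x : vabs x = 0 -> x = 0.
Proof.
move=> x0; apply/le_anti; have := vabs_ge x; have := vabs_geN x.
by rewrite x0 -{1}oppr0 vlerN2 => -> ->.
Qed.

Lemma riesz_decomposition x y z : 0 <= x -> 0 <= y -> 0 <= z -> z <= x + y ->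
  exists z1 z2, [/\ 0 <= z1 <= x, 0 <= z2 <= y & z = z1 + z2].
Proof.
move=> x0 y0 z0 zxy; exists (vmeet z x), (z - vmeet z x).
rewrite le_vmeet z0 x0 vmeet_ler vsubr_ge0 vmeet_lel/=; split=> //.
  by rewrite vlerBlDr addrC -vlerBlDr le_vmeet !vlerBlDr vlerDl.
by rewrite addrC subrK.
Qed.

Lemma vdisjointP x y : vdisjoint x y <->
  forall z, 0 <= z -> z <= vabs x -> z <= vabs y -> z = 0.
Proof.
split=> [dxy z z0 zx zy|]; last first.
  by apply; rewrite ?vmeet_lel ?vmeet_ler// le_vmeet !vabs_ge0.
by apply/le_anti; rewrite z0 -dxy le_vmeet zx zy.
Qed.

Lemma disjoint_compl_lin (B : set V) a x y : disjoint_compl B x ->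
  disjoint_compl B y -> disjoint_compl B (a *: x + y).
Proof.
move=> dx dy c Bc; apply/vdisjointP => z z0 zxy zc.
have /vdisjointP {}dx := dx _ Bc; have /vdisjointP {}dy := dy _ Bc.
have [||||z1 [z2 [/andP[z10 z1x] /andP[z20 z2y] ez]]] :=
    @riesz_decomposition (`|a| *: vabs x) (vabs y) z; rewrite ?vabs_ge0//.
- by rewrite vscaler_ge0 ?vabs_ge0.
- by apply: (le_trans zxy); apply: (le_trans (vabsD _ _)); rewrite vlerD2r// vabsZ.
have z2E : z2 = 0.
  by apply: dy => //; apply: le_trans zc; rewrite ez vlerDr.
have {}z1c : z1 <= vabs c by apply: le_trans zc; rewrite ez vlerDl.
have a1 : 0 < `|a| + 1 by rewrite ltr_wpDl.
have z1E : (`|a| + 1)^-1 *: z1 = 0.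
  apply: dx; first by rewrite vscaler_ge0// invr_ge0 ltW.
    rewrite -[vabs x](scalerK (lt0r_neq0 a1)) vlerZ ?invr_ge0 ?(ltW a1)//.
    by apply: (le_trans z1x); rewrite vlerZl ?vabs_ge0// lerDl.
  apply: le_trans z1c; rewrite -[X in _ <= X]scale1r vlerZl//.
  by rewrite invf_le1// lerDr.
by rewrite ez z2E addr0 -[z1](scalerKV (lt0r_neq0 a1)) z1E scaler0.
Qed.

End VectorLatticeTheory.

Section BandClosure.
Context {R : realType} {V : vectorLatticeType R} (B : set V).
Hypothesis bB : is_band B.
Implicit Types (x y : V) (a : R).

Lemma band0 : B 0. Proof. by case: bB => -[]. Qed.

Lemma band_lin a x y : B x -> B y -> B (a *: x + y).
Proof. by case: bB => -[_ + _] _; exact. Qed.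

Lemma bandD x y : B x -> B y -> B (x + y).
Proof. by move=> /(@band_lin 1 x) + /[dup]/[swap] => /[apply]; rewrite scale1r. Qed.

Lemma bandZ a x : B x -> B (a *: x).
Proof. by move=> /(@band_lin a x)/(_ band0); rewrite addr0. Qed.

Lemma bandB x y : B x -> B y -> B (x - y).
Proof. by move=> Bx By; rewrite -scaleN1r; apply: bandD => //; exact: bandZ. Qed.

Lemma band_solid x y : B y -> vabs x <= vabs y -> B x.
Proof. by case: bB => -[_ _ +] _; exact. Qed.

Lemma band_vabs x : B x -> B (vabs x).
Proof. by move=> /band_solid; apply; rewrite (vabs_id (vabs_ge0 x)). Qed.

Lemma band_le_abs2 x y z : B x -> B y -> vabs z <= vabs x + vabs y -> B z.
Proof.
move=> Bx By zxy; apply: (@band_solid _ (vabs x + vabs y)).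
  by apply: bandD; exact: band_vabs.
by rewrite [X in _ <= X]vabs_id// vaddr_ge0// vabs_ge0.
Qed.

Lemma band_vjoin x y : B x -> B y -> B (vjoin x y).
Proof.
move=> Bx By; apply: (band_le_abs2 Bx By).
rewrite vabs_le vjoin_le (le_trans (vabs_ge x)) ?vlerDl ?vabs_ge0//=.
rewrite (le_trans (vabs_ge y)) ?vlerDr ?vabs_ge0//=.
rewrite (le_trans _ (vlerDl _ (vabs_ge0 y)))// (le_trans _ (vabs_geN x))//.
by rewrite vlerN2 vjoin_lel.
Qed.

Lemma band_vmeet x y : B x -> B y -> B (vmeet x y).
Proof.
move=> Bx By; apply: (band_le_abs2 Bx By); rewrite vabs_le.
rewrite (le_trans (vmeet_lel x y))/=; last first.
  by rewrite (le_trans (vabs_ge x))// vlerDl ?vabs_ge0.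
rewrite -vlerN2 opprK le_vmeet -[in X in _ && X]vlerN2 -vlerN2 !opprK.
rewrite (le_trans (vabs_geN x)) ?vlerDl ?vabs_ge0//=.
by rewrite (le_trans (vabs_geN y)) ?vlerDr ?vabs_ge0.
Qed.

Lemma band_sup (A : set V) s : A `<=` B -> supremums A s -> B s.
Proof. by case: bB => _; exact. Qed.

End BandClosure.

Section OrderComplete.
Context {R : realType} {V : ocVectorLatticeType R}.
Implicit Types (x y : V) (A : set V).

Lemma vsupP A : A !=set0 -> has_ubound A -> supremums A (supremum 0 A).
Proof.
move=> A0 uA; rewrite /supremum; case: ifPn => [/eqP A0'|_].
  by move: A0; rewrite A0' => -[].
exact: (xgetPex _ (order_complete _ A0 uA)).
Qed.

Lemma vsup_ub A x : has_ubound A -> A x -> x <= supremum 0 A.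
Proof. by move=> uA Ax; apply: (vsupP _ uA).1 => //; exists x. Qed.

Lemma vsup_le A y : A !=set0 -> ubound A y -> supremum 0 A <= y.
Proof. by move=> A0 Ay; apply: (vsupP A0 _).2 => //; exists y. Qed.

Section BandProjection.
Variable B : set V.
Hypothesis bB : is_band B.

Let decomposition x b := B b /\ disjoint_compl B (x - b).

Let decomposition_pos x : 0 <= x -> exists2 b, decomposition x b & 0 <= b.
Proof.
move=> x0; pose S : set V := [set y | B y /\ 0 <= y <= x].
have S0 : S 0 by split; [exact: band0 bB|rewrite lexx].
have uS : has_ubound S by exists x => y [_ /andP[]].
have supS := vsupP (ex_intro _ _ S0) uS; set b := supremum 0 S in supS.
have Bb : B b by apply: (band_sup bB _ supS) => y [].
have b0 : 0 <= b by exact: supS.1.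
have bx : b <= x by apply: supS.2 => y [_ /andP[]].
exists b => //; split=> // c Bc; apply/vdisjointP => z z0 zxb zc.
have Bz : B z by apply: (band_solid bB Bc); rewrite vabs_id.
apply/le_anti; rewrite z0 andbT -(vlerD2rE b) add0r; apply: supS.1.
split; first exact: (bandD bB).
by rewrite vaddr_ge0//= -vlerBrDr -[X in _ <= X]vabs_id// vsubr_ge0.
Qed.

Let decomposition_uniq x b c : decomposition x b -> decomposition x c -> b = c.
Proof.
move=> [Bb db] [Bc dc]; apply/eqP; rewrite -subr_eq0; apply/eqP/vabs_eq0.
have : disjoint_compl B (b - c).
  have := @disjoint_compl_lin _ _ B (- 1) _ _ db dc.
  by rewrite scaleN1r opprB addrA subrK; exact.
move=> /(_ _ (bandB bB Bb Bc))/vdisjointP; apply => //; exact: vabs_ge0.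
Qed.

Lemma band_proj_spec x :
  B (band_proj B x) /\ disjoint_compl B (x - band_proj B x).
Proof.
apply: (@xgetPex _ 0 [set b | B b /\ disjoint_compl B (x - b)]).
have [b [Bb db] _] := decomposition_pos (vpos_ge0 x).
have [c [Bc dc] _] := decomposition_pos (vpos_ge0 (- x)).
exists (b - c); split; first exact: (bandB bB).
have -> : x - (b - c) = (vpos x - b) - (vpos (- x) - c).
  by rewrite -{1}(vposB x) !opprB [c - b]addrC addrACA [- _ + c]addrC.
by rewrite addrC -scaleN1r; exact: disjoint_compl_lin.
Qed.

Lemma band_projE x b : B b -> disjoint_compl B (x - b) -> band_proj B x = b.
Proof.
by move=> Bb db; apply: (@decomposition_uniq x) => //; exact: band_proj_spec.
Qed.

Lemma band_proj_linear : linear (band_proj B).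
Proof.
move=> a x y; have [Bx dx] := band_proj_spec x; have [By dy] := band_proj_spec y.
apply: band_projE; first exact: (band_lin bB).
by rewrite opprD addrACA -scalerBr; exact: disjoint_compl_lin.
Qed.

Lemma band_proj_ge0 x : 0 <= x -> 0 <= band_proj B x.
Proof. by move=> /decomposition_pos[b [Bb db] b0]; rewrite (@band_projE x b). Qed.

End BandProjection.
End OrderComplete.

Section ConeExtension.
Context {R : realType} {V W : vectorLatticeType R}.
Variable p : V -> W.
Hypothesis pD : forall x y, 0 <= x -> 0 <= y -> p (x + y) = p x + p y.
Hypothesis pZ : forall (a : R) x, 0 <= a -> 0 <= x -> p (a *: x) = a *: p x.

Definition cone_extension (x : V) : W := p (vpos x) - p (vpos (- x)).

Lemma cone_extensionB x y :
  0 <= x -> 0 <= y -> cone_extension (x - y) = p x - p y.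
Proof.
move=> x0 y0; apply/eqP; rewrite subr_eq addrAC eq_sym subr_eq eq_sym.
rewrite -!pD ?vpos_ge0//; apply/eqP; congr p.
by apply/eqP; rewrite -subr_eq addrAC vposB subrK.
Qed.

Lemma cone_extensionE x : 0 <= x -> cone_extension x = p x.
Proof.
move=> x0; rewrite -[in LHS](subr0 x) cone_extensionB//.
by have := pZ (lexx (0 : R)) (lexx (0 : V)); rewrite !scale0r => ->; rewrite subr0.
Qed.

Lemma cone_extension_linear : linear cone_extension.
Proof.
move=> a x y; rewrite -{1}(vposB x) -{1}(vposB y) [in RHS]/cone_extension.
have [a0|/ltW a0] := leP 0 a.
  rewrite scalerBr addrACA -opprD cone_extensionB ?vaddr_ge0 ?vscaler_ge0 ?vpos_ge0//.
  by rewrite !pD ?pZ ?vscaler_ge0 ?vpos_ge0// opprD addrACA -scalerBr.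
have Na0 : 0 <= - a by rewrite oppr_ge0.
rewrite -(opprK a) scaleNr -scalerN opprB scalerBr addrACA -opprD.
rewrite cone_extensionB ?vaddr_ge0 ?vscaler_ge0 ?vpos_ge0//.
rewrite !pD ?pZ ?vscaler_ge0 ?vpos_ge0// opprD addrACA -scalerBr.
by rewrite [in RHS]scaleNr -scalerN opprB.
Qed.

End ConeExtension.

Definition positive_map (R : realType) (V W : vectorLatticeType R) (T : V -> W) :=
  forall x, 0 <= x -> 0 <= T x.

Definition regular (R : realType) (V : vectorLatticeType R) : {pred V -> V} :=
  [pred T | `[< exists S1 S2 : {linear V -> V},
    [/\ positive_map S1, positive_map S2 & T = S1 \- S2] >]].

Record regular_operator (R : realType) (V : vectorLatticeType R) := RegularOperator {
  regular_fun :> V -> V;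
  regular_funP : regular_fun \in @regular R V
}.

Section RegularOperators.
Context {R : realType} {V : vectorLatticeType R}.

Definition linear_of (f : V -> V) (lf : linear f) : {linear V -> V} :=
  HB.pack f (GRing.isLinear.Build R V V *:%R f lf).

Lemma regularP (T : V -> V) : T \in @regular R V <->
  exists S1 S2 : {linear V -> V},
    [/\ positive_map S1, positive_map S2 & T = S1 \- S2].
Proof. by rewrite unfold_in /=; split=> /asboolP. Qed.

Fact regular_submod_closed : submod_closed (@regular R V).
Proof.
split=> [|a S T].
  apply/regularP; exists \0, \0; split=> [x _|x _|]; rewrite ?lexx//.
  by apply/funext => x /=; rewrite subrr.
move=> /regularP[S1 [S2 [S10 S20 ->]]] /regularP[T1 [T2 [T10 T20 ->]]].
apply/regularP; have [a0|/ltW a0] := leP 0 a.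
  exists ((a \*: S1) \+ T1), ((a \*: S2) \+ T2).
  split=> [x x0|x x0|] /=; rewrite ?vaddr_ge0 ?vscaler_ge0 ?S10 ?S20 ?T10 ?T20//.
  by apply/funext => x /=; rewrite !fctE /= scalerBr addrACA -opprD.
have Na0 : 0 <= - a by rewrite oppr_ge0.
exists ((- a \*: S2) \+ T1), ((- a \*: S1) \+ T2).
split=> [x x0|x x0|] /=; rewrite ?vaddr_ge0 ?vscaler_ge0 ?S10 ?S20 ?T10 ?T20//.
apply/funext => x /=; rewrite !fctE /= -{1}(opprK a) scaleNr -scalerN opprB.
by rewrite scalerBr addrACA -opprD.
Qed.

HB.instance Definition _ :=
  GRing.isSubmodClosed.Build R (V -> V) (@regular R V) regular_submod_closed.

HB.instance Definition _ := [isSub for @regular_fun R V].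
HB.instance Definition _ := [Choice of regular_operator V by <:].
HB.instance Definition _ :=
  [SubChoice_isSubLmodule of regular_operator V by <:].

Fact regular_fun_linear (T : regular_operator V) : linear T.
Proof.
case: T => T /= /regularP[S1 [S2 [_ _ ->]]].
exact: linearP.
Qed.

HB.instance Definition _ (T : regular_operator V) :=
  GRing.isLinear.Build R V V *:%R T (regular_fun_linear T).

Implicit Types S T : regular_operator V.

Definition regular_le S T := `[< forall x, 0 <= x -> S x <= T x >].

Lemma regular_ext S T : (forall x, 0 <= x -> S x = T x) -> S = T.
Proof.
move=> ST; apply/val_inj/funext => x /=.
by rewrite -(vposB x) !linearB /= !ST ?vpos_ge0.
Qed.

Fact regular_le_refl : reflexive regular_le.
Proof. by move=> T; apply/asboolP => x _. Qed.

Fact regular_le_anti : antisymmetric regular_le.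
Proof.
move=> S T /andP[/asboolP ST /asboolP TS]; apply: regular_ext => x x0.
by apply/le_anti; rewrite ST ?TS.
Qed.

Fact regular_le_trans : transitive regular_le.
Proof.
move=> S T U /asboolP TS /asboolP SU; apply/asboolP => x x0.
exact: le_trans (TS _ x0) (SU _ x0).
Qed.

HB.instance Definition _ := Order.Le_isPOrder.Build ring_display
  (regular_operator V) regular_le_refl regular_le_anti regular_le_trans.

Lemma regular_leP S T : S <= T <-> forall x, 0 <= x -> S x <= T x.
Proof. by split=> /asboolP. Qed.

Lemma regularDE S T x : (S + T) x = S x + T x. Proof. by []. Qed.
Lemma regularBE S T x : (S - T) x = S x - T x. Proof. by []. Qed.
Lemma regularZE (a : R) T x : (a *: T) x = a *: T x. Proof. by []. Qed.

Fact regular_leD2r U S T : S <= T -> S + U <= T + U.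
Proof.
by move=> /regular_leP ST; apply/regular_leP => x x0; rewrite !regularDE vlerD2r ?ST.
Qed.

Fact regular_scale_ge0 (a : R) T : 0 <= a -> 0 <= T -> 0 <= a *: T.
Proof.
move=> a0 /regular_leP T0; apply/regular_leP => x x0.
by rewrite regularZE vscaler_ge0// T0.
Qed.

Lemma positive_regular (f : V -> V) :
  linear f -> positive_map f -> f \in @regular R V.
Proof.
move=> lf f0; apply/regularP; exists (linear_of lf), \0; split=> //.
by apply/funext => x /=; rewrite subr0.
Qed.

End RegularOperators.

Section RegularLattice.
Context {R : realType} {V : ocVectorLatticeType R}.

Let homogeneous_le (p : V -> V) : p 0 = 0 ->
  (forall (a : R) x, 0 < a -> 0 <= x -> p (a *: x) <= a *: p x) ->
  forall (a : R) x, 0 <= a -> 0 <= x -> p (a *: x) = a *: p x.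
Proof.
move=> p0 pZ a x; rewrite le_eqVlt => /predU1P[<- _|a0 x0].
  by rewrite !scale0r.
apply/le_anti; rewrite pZ//=.
have a1 : 0 < a^-1 by rewrite invr_gt0.
have := pZ a^-1 (a *: x) a1 (vscaler_ge0 _ _ (ltW a0) x0).
rewrite scalerK ?gt_eqF// => /(vlerZ (ltW a0)).
by rewrite scalerKV ?gt_eqF.
Qed.

Implicit Types S T U : regular_operator V.

Lemma regular_dominated T : exists S : {linear V -> V},
  positive_map S /\ forall x, 0 <= x -> T x <= S x.
Proof.
case: T => T /= /regularP[S1 [S2 [S10 S20 ->]]]; exists S1; split=> // x x0.
by rewrite /= vlerBlDr vlerDl// S20.
Qed.

Section PositivePart.
Variable T : regular_operator V.

Let values (x : V) : set V := [set T y | y in [set y | 0 <= y <= x]].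
Let p (x : V) : V := supremum 0 (values x).

Let values0 x : 0 <= x -> values x 0.
Proof. by move=> x0; exists 0; rewrite ?linear0//= lexx. Qed.

Let values_ub x : has_ubound (values x).
Proof.
have [S [S0 TS]] := regular_dominated T; exists (S x) => _ [y /andP[y0 yx] <-].
apply: le_trans (TS _ y0) _.
by rewrite -vsubr_ge0 -linearB S0// vsubr_ge0.
Qed.

Let p_ge x y : 0 <= y -> y <= x -> T y <= p x.
Proof. by move=> y0 yx; apply: vsup_ub => //; exists y => //=; rewrite y0. Qed.

Let p_le x z : 0 <= x -> (forall y, 0 <= y -> y <= x -> T y <= z) -> p x <= z.
Proof.
move=> x0 Tz; apply: vsup_le; first by exists 0; exact: values0.
by move=> _ [y /andP[y0 yx] <-]; exact: Tz.
Qed.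

Let pD x y : 0 <= x -> 0 <= y -> p (x + y) = p x + p y.
Proof.
move=> x0 y0; have xy0 := vaddr_ge0 x0 y0; apply/le_anti/andP; split.
  apply: (p_le) => // z z0 zxy.
  have [z1 [z2 [/andP[z10 z1x] /andP[z20 z2y] ->]]] :=
    riesz_decomposition x0 y0 z0 zxy.
  by rewrite linearD vlerD// p_ge.
rewrite -vlerBrDr; apply: (p_le) => // z1 z10 z1x.
rewrite vlerBrDr addrC -vlerBrDr; apply: (p_le) => // z2 z20 z2y.
by rewrite vlerBrDr -linearD p_ge ?vaddr_ge0// addrC vlerD.
Qed.

Let pZ (a : R) x : 0 <= a -> 0 <= x -> p (a *: x) = a *: p x.
Proof.
move: a x; apply: homogeneous_le => [|a x a0 x0].
  apply/le_anti/andP; split; last by rewrite -[X in X <= _](linear0 T) p_ge.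
  by apply: (p_le) => // y y0 y0'; rewrite (@le_anti _ _ y 0) ?linear0// y0 y0'.
apply: (p_le) => [|y y0 yx]; first by rewrite vscaler_ge0// ltW.
have -> : y = a *: (a^-1 *: y) by rewrite scalerKV// gt_eqF.
have a1 : 0 <= a^-1 by rewrite invr_ge0 ltW.
rewrite linearZ vlerZ ?(ltW a0)// p_ge ?vscaler_ge0//.
by have := vlerZ a1 yx; rewrite scalerK// gt_eqF.
Qed.

Let p_ge0 : positive_map (cone_extension p).
Proof.
by move=> x x0; rewrite (cone_extensionE pD pZ)// -[X in X <= _](linear0 T) p_ge.
Qed.

Definition regular_pospart : regular_operator V :=
  RegularOperator (positive_regular (cone_extension_linear pD pZ) p_ge0).

Lemma regular_pospart_le U : (regular_pospart <= U) = (T <= U) && (0 <= U).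
Proof.
apply/idP/andP => [/regular_leP pU|[/regular_leP TU /regular_leP U0]].
  split; apply/regular_leP => x x0; apply: le_trans (pU _ x0).
    by rewrite /= (cone_extensionE pD pZ)// p_ge.
  exact: p_ge0.
apply/regular_leP => x x0; rewrite /= (cone_extensionE pD pZ)//.
apply: (p_le) => // y y0 yx; apply: le_trans (TU _ y0) _.
by rewrite -vsubr_ge0 -linearB U0// vsubr_ge0.
Qed.

End PositivePart.

HB.instance Definition _ := Lmodule_hasPositivePart.Build R (regular_operator V)
  (@regular_leD2r R V) (@regular_scale_ge0 R V) regular_pospart_le.

Fact regular_order_complete (A : set (regular_operator V)) :
  A !=set0 -> has_ubound A -> supremums A !=set0.
Proof.
move=> [T0 AT0] [U AU].
pose D : set (regular_operator V) := [set S | forall C : set (regular_operator V),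
  A `<=` C -> (forall S1 S2, C S1 -> C S2 -> C (vjoin S1 S2)) -> C S].
have AD : A `<=` D by move=> S AS C sAC _; exact: sAC.
have DJ S1 S2 : D S1 -> D S2 -> D (vjoin S1 S2).
  by move=> D1 D2 C sAC CJ; apply: (CJ); [exact: D1|exact: D2].
have DU W : ubound A W -> ubound D W.
  move=> AW S DS; apply: (DS [set S | S <= W]) => // S1 S2 /= S1W S2W.
  by rewrite vjoin_le S1W.
pose p (x : V) : V := supremum 0 [set S x | S in D].
have p_ge x S : 0 <= x -> D S -> S x <= p x.
  move=> x0 DS; apply: vsup_ub; last by exists S.
  by exists (U x) => _ [T DT <-]; move/regular_leP : (DU _ AU _ DT); exact.
have p_le x z : (forall S, D S -> S x <= z) -> p x <= z.
  move=> Dz; apply: vsup_le; first by exists (T0 x), T0 => //; exact: AD.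
  by move=> _ [S DS <-]; exact: Dz.
have pD x y : 0 <= x -> 0 <= y -> p (x + y) = p x + p y.
  move=> x0 y0; apply/le_anti/andP; split.
    by apply: (p_le) => S DS; rewrite linearD vlerD// p_ge.
  rewrite -vlerBrDr; apply: (p_le) => S1 D1.
  rewrite vlerBrDr addrC -vlerBrDr; apply: (p_le) => S2 D2; rewrite vlerBrDr.
  apply: (@le_trans _ _ (vjoin S1 S2 (x + y))); last first.
    by rewrite p_ge ?vaddr_ge0//; exact: DJ.
  rewrite linearD addrC.
  move/regular_leP : (vjoin_lel S1 S2) => /(_ _ x0) S1J.
  move/regular_leP : (vjoin_ler S1 S2) => /(_ _ y0) S2J.
  exact: vlerD.
have pZ (a : R) x : 0 <= a -> 0 <= x -> p (a *: x) = a *: p x.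
  move: a x; apply: homogeneous_le => [|a x a0 x0].
    apply/le_anti/andP; split; first by apply: (p_le) => S _; rewrite linear0.
    by rewrite -[X in X <= _](linear0 T0) p_ge//; exact: AD.
  by apply: (p_le) => S DS; rewrite linearZ vlerZ ?(ltW a0)// p_ge.
pose L := linear_of (cone_extension_linear pD pZ).
have LT_linear : linear (L \- T0) by exact: linearP.
have LT_ge0 : positive_map (L \- T0).
  move=> x x0; rewrite /= vsubr_ge0 (cone_extensionE pD pZ)// p_ge//; exact: AD.
exists (RegularOperator (positive_regular LT_linear LT_ge0) + T0); split.
  move=> S AS; apply/regular_leP => x x0; rewrite regularDE /= subrK.
  by rewrite (cone_extensionE pD pZ)// p_ge//; exact: AD.
move=> W AW; apply/regular_leP => x x0; rewrite regularDE /= subrK.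
rewrite (cone_extensionE pD pZ)//; apply: (p_le) => S DS.
by move/regular_leP : (DU _ AW _ DS); exact.
Qed.

HB.instance Definition _ :=
  isOrderComplete.Build R (regular_operator V) regular_order_complete.

End RegularLattice.

Section Diagonal.
Context {R : realType} {V : ocVectorLatticeType R}.

Definition order_bounded (T : V -> V) := forall a b : V,
  exists c d : V, forall x, a <= x <= b -> c <= T x <= d.

(* On an order complete vector lattice, the order bounded operators are
   exactly the regular ones. *)
Definition orthomorphisms : set (regular_operator V) :=
  [set T | order_bounded T /\
    forall B : set V, is_band B -> forall x, B x -> B (T x)].

Definition op_diagonal (T : regular_operator V) : regular_operator V :=
  band_proj orthomorphisms T.

End Diagonal.

Definition band_pred (R : realType) (V : vectorLatticeType R) (B : band V) :
  {pred V} := [pred x | `[< band_set B x >]].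

Record band_space (R : realType) (V : vectorLatticeType R) (B : band V) :=
  BandSpace { band_val : V; band_valP : band_val \in band_pred B }.

Arguments band_val {R V B} _.

Section BandSpace.
Context {R : realType} {V : ocVectorLatticeType R} (B : band V).

Lemma band_predP x : x \in band_pred B <-> band_set B x.
Proof. by rewrite unfold_in /=; split=> /asboolP. Qed.

Fact band_submod_closed : submod_closed (band_pred B).
Proof.
split=> [|a x y /band_predP Bx /band_predP By]; apply/band_predP.
  exact: band0 (bandP B).
exact: (band_lin (bandP B)).
Qed.

HB.instance Definition _ :=
  GRing.isSubmodClosed.Build R V (band_pred B) band_submod_closed.
HB.instance Definition _ := [isSub for @band_val R V B].
HB.instance Definition _ := [Choice of band_space B by <:].
HB.instance Definition _ := [SubChoice_isSubLmodule of band_space B by <:].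

Implicit Types x y z : band_space B.

Definition band_le x y := band_val x <= band_val y.

Fact band_le_refl : reflexive band_le. Proof. by move=> x; exact: lexx. Qed.

Fact band_le_anti : antisymmetric band_le.
Proof. by move=> x y xy; apply/val_inj/le_anti. Qed.

Fact band_le_trans : transitive band_le.
Proof. by move=> x y z; exact: le_trans. Qed.

HB.instance Definition _ := Order.Le_isPOrder.Build ring_display
  (band_space B) band_le_refl band_le_anti band_le_trans.

Fact band_leD2r z x y : x <= y -> x + z <= y + z.
Proof. exact: vlerD2r. Qed.

Fact band_scale_ge0 (a : R) x : 0 <= a -> 0 <= x -> 0 <= a *: x.
Proof. exact: vscaler_ge0. Qed.

Lemma band_valB x : band_set B (band_val x).
Proof. exact/band_predP/band_valP. Qed.

Definition band_elt (v : V) (Bv : band_set B v) : band_space B :=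
  BandSpace ((band_predP v).2 Bv).

Definition band_join x y : band_space B :=
  band_elt (band_vjoin (bandP B) (band_valB x) (band_valB y)).

Definition band_meet x y : band_space B :=
  band_elt (band_vmeet (bandP B) (band_valB x) (band_valB y)).

Fact band_join_le x y z : (band_join x y <= z) = (x <= z) && (y <= z).
Proof. exact: vjoin_le. Qed.

Fact band_le_meet x y z : (z <= band_meet x y) = (z <= x) && (z <= y).
Proof. exact: le_vmeet. Qed.

HB.instance Definition _ := isVectorLattice.Build R (band_space B)
  band_leD2r band_scale_ge0 band_join_le band_le_meet.

Fact band_order_complete (A : set (band_space B)) :
  A !=set0 -> has_ubound A -> supremums A !=set0.
Proof.
move=> [a Aa] [u Au]; pose A' := [set band_val x | x in A].
have supA : supremums A' (supremum 0 A').
  apply: vsupP; first by exists (band_val a), a.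
  by exists (band_val u) => _ [x Ax <-]; exact: Au.
have Bs : band_set B (supremum 0 A').
  by apply: (band_sup (bandP B) _ supA) => _ [x _ <-]; exact: band_valB.
exists (band_elt Bs); split=> [x Ax|y Ay]; first by apply: supA.1; exists x.
by apply: supA.2 => _ [x Ax <-]; exact: Ay.
Qed.

HB.instance Definition _ :=
  isOrderComplete.Build R (band_space B) band_order_complete.

Definition band_corestrict (x : V) : band_space B :=
  band_elt (band_proj_spec (bandP B) x).1.

Fact band_corestrict_linear : linear band_corestrict.
Proof. by move=> a x y; apply/val_inj/(band_proj_linear (bandP B)). Qed.

HB.instance Definition _ := GRing.isLinear.Build R V (band_space B) *:%R
  band_corestrict band_corestrict_linear.

Fact band_val_linear : linear (@band_val R V B).
Proof. by []. Qed.

HB.instance Definition _ := GRing.isLinear.Build R (band_space B) V *:%R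
  (@band_val R V B) band_val_linear.

Lemma band_corestrict_ge0 : positive_map band_corestrict.
Proof. by move=> x; exact: (band_proj_ge0 (bandP B)). Qed.

Lemma band_val_ge0 : positive_map (@band_val R V B).
Proof. by []. Qed.

Fact compression_regular (T : regular_operator V) :
  band_corestrict \o T \o @band_val R V B \in @regular R (band_space B).
Proof.
have /regularP[S1 [S2 [S10 S20 TE]]] := regular_funP T; apply/regularP.
exists (band_corestrict \o S1 \o @band_val R V B).
exists (band_corestrict \o S2 \o @band_val R V B).
split=> [x x0|x x0|].
- by apply: band_corestrict_ge0; apply: S10; exact: band_val_ge0.
- by apply: band_corestrict_ge0; apply: S20; exact: band_val_ge0.
- by apply/funext => x; rewrite /= TE; exact: (linearB band_corestrict).
Qed.

(* P_B T P_B as an operator on the vector lattice B *)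
Definition compression (T : regular_operator V) :
  regular_operator (band_space B) := RegularOperator (compression_regular T).

Fact band_extension_regular (D : regular_operator (band_space B)) :
  @band_val R V B \o D \o band_corestrict \in @regular R V.
Proof.
have /regularP[S1 [S2 [S10 S20 DE]]] := regular_funP D; apply/regularP.
exists (@band_val R V B \o S1 \o band_corestrict).
exists (@band_val R V B \o S2 \o band_corestrict).
split=> [x x0|x x0|].
- by apply: band_val_ge0; apply: S10; exact: band_corestrict_ge0.
- by apply: band_val_ge0; apply: S20; exact: band_corestrict_ge0.
- by apply/funext => x; rewrite /= DE; exact: (linearB (@band_val R V B)).
Qed.

(* the extension of an operator on B to V vanishing on B^d *)
Definition band_extension (D : regular_operator (band_space B)) :
  regular_operator V := RegularOperator (band_extension_regular D).

Definition band_diagonal (T : regular_operator V) : regular_operator V :=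
  band_extension (op_diagonal (compression T)).

End BandSpace.

Definition atomic_diagonal (R : realType) (V : ocVectorLatticeType R)
    (T : regular_operator V) : regular_operator V :=
  band_diagonal (atomic_part V) T.

HB.mixin Record hasLatticeNorm (R : realType) (V : Type)
    & VectorLattice R V := {
  vnorm : V -> R;
  vnormD : forall x y, vnorm (x + y) <= vnorm x + vnorm y;
  vnormZ : forall (a : R) (x : V), vnorm (a *: x) = `|a| * vnorm x;
  vnorm0_eq0 : forall x, vnorm x = 0 -> x = 0;
  le_vnorm : forall x y : V, vabs x <= vabs y -> vnorm x <= vnorm y
}.

#[short(type="normedLatticeType")]
HB.structure Definition NormedLattice (R : realType) :=
  {V of VectorLattice R V & hasLatticeNorm R V}.

(* V as a normed space, without its order *)
Definition normed_space (R : realType) (V : normedLatticeType R) : Type := V.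

HB.instance Definition _ (R : realType) (V : normedLatticeType R) :=
  GRing.Lmodule.copy (normed_space V) V.
HB.instance Definition _ (R : realType) (V : normedLatticeType R) :=
  Lmodule_isNormed.Build R (normed_space V)
    (@vnormD R V) (@vnormZ R V) (@vnorm0_eq0 R V).

HB.mixin Record isNormComplete (R : realType) (V : Type)
    & NormedLattice R V := {
  vnorm_complete : forall F : set_system (normed_space V),
    ProperFilter F -> cauchy F -> cvg F
}.

#[short(type="banachLatticeType")]
HB.structure Definition BanachLattice (R : realType) :=
  {V of NormedLattice R V & isNormComplete R V}.

#[short(type="ocBanachLatticeType")]
HB.structure Definition OCBanachLattice (R : realType) :=
  {V of BanachLattice R V & isOrderComplete R V}.

HB.instance Definition _ (R : realType) (V : banachLatticeType R) :=
  Uniform_isComplete.Build (normed_space V) (@vnorm_complete R V).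

Definition complexification (R : realType) (E : ocBanachLatticeType R) : Type :=
  (E * E)%type.

Section Complexification.
Context {R : realType} {E : ocBanachLatticeType R}.
Local Notation EC := (complexification E).
Local Notation Re := complex.Re.
Local Notation Im := complex.Im.
Local Open Scope complex_scope.

HB.instance Definition _ := GRing.Zmodule.copy EC (E * E)%type.

Implicit Types (c d : R[i]) (z w : EC) (x y : E) (a b : R).

(* (a + i b) (x + i y) = (a x - b y) + i (a y + b x) *)
Definition cscale c z : EC :=
  (Re c *: z.1 - Im c *: z.2, Re c *: z.2 + Im c *: z.1).

Fact cscaleA c d z : cscale c (cscale d z) = cscale (c * d) z.
Proof.
case: c d z => a b [a' b'] [x y]; rewrite /cscale /=; congr pair.
  rewrite scalerBr scalerDr !scalerA scalerBl scalerDl !opprD.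
  by rewrite -!addrA; congr (_ + _); rewrite addrA addrC.
rewrite scalerBr scalerDr !scalerA scalerBl scalerDl -!addrA; congr (_ + _).
by rewrite addrA addrC.
Qed.

Fact cscale1 : left_id 1 cscale.
Proof. by move=> [x y]; rewrite /cscale /= !scale1r !scale0r subr0 addr0. Qed.

Fact cscaleDr : right_distributive cscale +%R.
Proof.
move=> [a b] [x y] [x' y']; rewrite /cscale /= !scalerDr opprD.
by congr pair; rewrite addrACA.
Qed.

Fact cscaleDl z : {morph cscale^~ z : c d / c + d}.
Proof.
move=> [a b] [a' b']; case: z => x y; rewrite /cscale /= !scalerDl opprD.
by congr pair; rewrite addrACA.
Qed.

HB.instance Definition _ := GRing.Zmodule_isLmodule.Build R[i] EC
  cscaleA cscale1 cscaleDr cscaleDl.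

(* |x + i y| = sup {(cos t) x + (sin t) y | t real} *)
Definition rotated_parts z : set E :=
  [set u | exists a b : R, a ^+ 2 + b ^+ 2 = 1 /\ u = a *: z.1 + b *: z.2].

Definition cmodulus z : E := supremum 0 (rotated_parts z).

Lemma rotated_parts_ub z : ubound (rotated_parts z) (vabs z.1 + vabs z.2).
Proof.
move=> _ [a [b [ab ->]]].
have le1 (r s : R) : r ^+ 2 + s ^+ 2 = 1 -> `|r| <= 1.
  move=> rs; rewrite -(@ler_pXn2r _ 2) ?nnegrE// real_normK ?num_real//.
  by rewrite expr1n -rs lerDl sqr_ge0.
apply: vlerD; (apply: le_trans (vabs_ge _) _; apply: le_trans (vabsZ _ _) _).
  by rewrite -[X in _ <= X]scale1r vlerZl ?vabs_ge0// (le1 _ _ ab).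
rewrite -[X in _ <= X]scale1r vlerZl ?vabs_ge0//.
by apply: (le1 _ a); rewrite addrC.
Qed.

Lemma rotated_parts0 z : rotated_parts z z.1.
Proof.
by exists 1, 0; rewrite expr1n expr0n/= addr0 scale1r scale0r addr0.
Qed.

Lemma cmodulus_ge z a b :
  a ^+ 2 + b ^+ 2 = 1 -> a *: z.1 + b *: z.2 <= cmodulus z.
Proof. move=> ab; apply: vsup_ub; last by exists a, b.
by exists (vabs z.1 + vabs z.2); exact: rotated_parts_ub. Qed.

Lemma cmodulus_le z x :
  (forall a b, a ^+ 2 + b ^+ 2 = 1 -> a *: z.1 + b *: z.2 <= x) ->
  cmodulus z <= x.
Proof.
move=> zx; apply: vsup_le => [|_ [a [b [ab ->]]]]; last exact: zx.
by exists z.1; exact: rotated_parts0.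
Qed.

Lemma cmodulus_re z : vabs z.1 <= cmodulus z.
Proof.
rewrite vabs_le; apply/andP; split.
  by have := @cmodulus_ge z 1 0; rewrite scale1r scale0r addr0; apply;
    rewrite expr1n expr0n/= addr0.
by have := @cmodulus_ge z (- 1) 0; rewrite scaleN1r scale0r addr0; apply;
  rewrite sqrrN expr1n expr0n/= addr0.
Qed.

Lemma cmodulus_im z : vabs z.2 <= cmodulus z.
Proof.
rewrite vabs_le; apply/andP; split.
  by have := @cmodulus_ge z 0 1; rewrite scale1r scale0r add0r; apply;
    rewrite expr1n expr0n/= add0r.
by have := @cmodulus_ge z 0 (- 1); rewrite scaleN1r scale0r add0r; apply;
  rewrite sqrrN expr1n expr0n/= add0r.
Qed.

Lemma cmodulus_ge0 z : 0 <= cmodulus z.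
Proof. exact: le_trans (vabs_ge0 _) (cmodulus_re z). Qed.

Lemma cmodulusD z w : cmodulus (z + w) <= cmodulus z + cmodulus w.
Proof.
apply: cmodulus_le => a b ab; rewrite !scalerDr addrACA.
by rewrite vlerD// cmodulus_ge.
Qed.

Let cmodulusZ_le c z : c != 0 -> cmodulus (c *: z) <= complex.Re `|c| *: cmodulus z.
Proof.
move=> c0; apply: cmodulus_le => a b ab.
case: c c0 => p q c0; rewrite normc_def /=; set r := Num.sqrt _.
have r2 : r ^+ 2 = p ^+ 2 + q ^+ 2 by rewrite sqr_sqrtr// addr_ge0 ?sqr_ge0.
have r0 : 0 < r.
  rewrite lt_neqAle sqrtr_ge0 andbT eq_sym -sqrf_eq0 r2.
  rewrite paddr_eq0 ?sqr_ge0// !sqrf_eq0.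
  by move: c0; rewrite eq_complex.
pose a' := (a * p + b * q) / r; pose b' := (b * p - a * q) / r.
have ab' : a' ^+ 2 + b' ^+ 2 = 1.
  rewrite !exprMn -mulrDl exprVn r2.
  have -> : (a * p + b * q) ^+ 2 + (b * p - a * q) ^+ 2 =
            (a ^+ 2 + b ^+ 2) * (p ^+ 2 + q ^+ 2) by ring.
  by rewrite ab mul1r divff// -r2 expf_neq0// gt_eqF.
have -> : a *: (p *: z.1 - q *: z.2) + b *: (p *: z.2 + q *: z.1) =
          r *: (a' *: z.1 + b' *: z.2).
  rewrite !scalerDr scalerN !scalerA ![r * _]mulrC !divfK ?gt_eqF//.
  rewrite scalerBl scalerDl [X in _ + X = _]addrC addrACA; congr (_ + _).
  by rewrite addrC.
by rewrite vlerZ ?(ltW r0)// cmodulus_ge.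
Qed.

Lemma cmodulusZ c z : cmodulus (c *: z) = complex.Re `|c| *: cmodulus z.
Proof.
have [->|c0] := eqVneq c 0.
  rewrite normr0 !scale0r; apply/le_anti; rewrite cmodulus_ge0 andbT.
  by apply: cmodulus_le => a b _; rewrite !scaler0 addr0.
apply/le_anti; rewrite cmodulusZ_le//=.
have := cmodulusZ_le (c *: z) (invr_neq0 c0); rewrite scalerK//.
have c1 : 0 < complex.Re `|c|.
  by have := c0; rewrite -normr_gt0 ltcE => /andP[].
have -> : complex.Re `|c^-1| = (complex.Re `|c|)^-1.
  have -> : `|c^-1| = (complex.Re `|c|)^-1%:C; last by [].
  by rewrite normfV -[in LHS](RRe_real (normr_real c)) fmorphV.
move=> /(vlerZ (ltW c1)); by rewrite scalerKV// gt_eqF.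
Qed.

Lemma vnorm0 : vnorm (0 : E) = 0.
Proof. by have := vnormZ 0 (0 : E); rewrite scale0r normr0 mul0r. Qed.

Lemma vnorm_le x y : 0 <= x -> x <= y -> vnorm x <= vnorm y.
Proof. by move=> x0 xy; rewrite le_vnorm// !vabs_id// (le_trans x0). Qed.

Lemma vnorm_vabs x : vnorm (vabs x) = vnorm x.
Proof. by apply/le_anti; rewrite !le_vnorm// (vabs_id (vabs_ge0 x)). Qed.

Definition cnorm z : R[i] := (vnorm (cmodulus z))%:C.

Fact cnormD z w : cnorm (z + w) <= cnorm z + cnorm w.
Proof.
rewrite /cnorm -rmorphD lecR (le_trans _ (vnormD _ _))//.
by rewrite vnorm_le ?cmodulus_ge0 ?cmodulusD.
Qed.

Fact cnormZ c z : cnorm (c *: z) = `|c| * cnorm z.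
Proof.
rewrite /cnorm cmodulusZ vnormZ -[in RHS](RRe_real (normr_real c)) -rmorphM.
rewrite ger0_norm//.
by have := normr_ge0 c; rewrite lecE => /andP[].
Qed.

Fact cnorm0_eq0 z : cnorm z = 0 -> z = 0.
Proof.
move=> /complexI/vnorm0_eq0 z0; have := cmodulus_re z; have := cmodulus_im z.
rewrite z0 [z]surjective_pairing => z2 z1; congr pair; apply: vabs_eq0.
  by apply/le_anti; rewrite z1 vabs_ge0.
by apply/le_anti; rewrite z2 vabs_ge0.
Qed.

HB.instance Definition _ := Lmodule_isNormed.Build R[i] EC
  cnormD cnormZ cnorm0_eq0.

Lemma cnormE z : `|z| = (vnorm (cmodulus z))%:C.
Proof. by []. Qed.

Lemma cmodulus_le_abs z : cmodulus z <= vabs z.1 + vabs z.2.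
Proof.
by apply: vsup_le; [exists z.1; exact: rotated_parts0|exact: rotated_parts_ub].
Qed.

Fact complexification_complete (F : set_system EC) :
  ProperFilter F -> cauchy F -> cvg F.
Proof.
move=> FF /cauchyP Fc.
have cvg_part (f : EC -> normed_space E) : {morph f : z w / z - w} ->
    (forall z, vnorm (f z : E) <= vnorm (cmodulus z)) -> cvg (f @ F).
  move=> fB f_le; apply: vnorm_complete; apply/cauchyP => e e0.
  have /Fc[z Fz] : 0 < e%:C by rewrite ltcR.
  exists (f z); rewrite /nbhs /=; move: Fz; apply: filterS => w.
  rewrite -!ball_normE /= => zw; rewrite -fB (le_lt_trans (f_le _))//.
  by rewrite -ltcR.
have /cvg_ex[l1 Fl1] : cvg ((fun z : EC => z.1 : normed_space E) @ F).
  apply: cvg_part => // z; rewrite -vnorm_vabs.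
  by rewrite vnorm_le ?vabs_ge0 ?cmodulus_re.
have /cvg_ex[l2 Fl2] : cvg ((fun z : EC => z.2 : normed_space E) @ F).
  apply: cvg_part => // z; rewrite -vnorm_vabs.
  by rewrite vnorm_le ?vabs_ge0 ?cmodulus_im.
apply/cvg_ex; exists ((l1, l2) : EC); apply/cvgrPdist_lt => e e0.
have eE : e = (complex.Re e)%:C by rewrite RRe_real// gtr0_real.
have r0 : 0 < complex.Re e by rewrite -ltcR -eE.
rewrite eE; set r := complex.Re e in r0 *.
have r2 : 0 < r / 2 by rewrite divr_gt0.
move/cvgrPdist_lt : Fl1 => /(_ _ r2) Fl1.
move/cvgrPdist_lt : Fl2 => /(_ _ r2) Fl2.
near=> z; rewrite cnormE ltcR (le_lt_trans (vnorm_le (cmodulus_ge0 _) (cmodulus_le_abs _)))//.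
rewrite (le_lt_trans (vnormD _ _))// !vnorm_vabs [r]splitr.
by apply: ltrD; [near: z; exact: Fl1|near: z; exact: Fl2].
Unshelve. all: by end_near. Qed.

HB.instance Definition _ :=
  Uniform_isComplete.Build EC complexification_complete.

End Complexification.

Section ComplexifiedOperator.
Context {R : realType} {E : ocBanachLatticeType R}.

Definition complexify (T : E -> E) (z : complexification E) :
  complexification E := (T z.1, T z.2).

Fact complexify_linear (T : {linear E -> E}) : linear (complexify T).
Proof.
move=> c z w; congr pair; rewrite /= linearD; congr (_ + _).
  by rewrite linearB !linearZ.
by rewrite linearD !linearZ.
Qed.

HB.instance Definition _ (T : {linear E -> E}) :=
  GRing.isLinear.Build R[i] (complexification E) (complexification E) *:%R
    (complexify T) (complexify_linear T).

End ComplexifiedOperator.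

Section RieszOperators.
Context {R : realType} {X : completeNormedModType R[i]}.
Local Open Scope complex_scope.

Definition op_bounds (T : X -> X) : set R :=
  [set M | 0 <= M /\ forall x, `|T x| <= M%:C * `|x|].

Definition bounded_operator (T : X -> X) := op_bounds T !=set0.

Definition opnorm (T : X -> X) : R := inf (op_bounds T).

Definition compact_operator (K : X -> X) :=
  precompact [set K x | x in [set x : X | `|x| <= 1]].

(* the norm of the image of T in the quotient of the bounded operators by the
   compact ones *)
Definition calkin_norm (T : X -> X) : R :=
  inf [set opnorm (T \- K) | K in
        [set K : {linear X -> X} | compact_operator K]].

Definition riesz_operator (T : {linear X -> X}) :=
  bounded_operator T /\
  calkin_norm (iter n T) `^ n%:R^-1 @[n --> \oo] --> (0 : R).

End RieszOperators.

(* Main.v *)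
Require Import Defs.
From mathcomp Require Import all_boot all_order all_algebra.
From mathcomp Require Import complex lra finmap.
From mathcomp Require Import boolp classical_sets functions reals topology.
From mathcomp Require Import normedtype sequences exp.

(** The diagonal D of a positive operator T is the largest orthomorphism below
    T, so 0 <= D <= T.  The diagonal of the compression of T to a band is the
    compression of D ([compression_diagonal]), so the diagonal of T and its
    diagonal relative to a band B agree as soon as D vanishes on B^d
    ([band_diagonal_eq]).  The theorem thus reduces to showing that D vanishes on
    the disjoint complement of the atoms.

    Suppose D x is non-zero for some x >= 0 disjoint from all atoms.  The positive
    part of D x - lam x, for small lam > 0, generates a band in which the
    component x' of x satisfies T e >= D e >= lam e for every component e of x'
    ([orthomorphism_lower_bound]); hence T^n e >= lam^n e for all n.  As T is a
    Riesz operator, for some n the iterate S = T^n is at distance eta < lam^n from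
    a compact operator K.  This is impossible on the atomless element x'
    ([atomless_not_compact]), for three reasons that conflict.

    - If x' = e_1 + ... + e_k is a decomposition into disjoint components, the
      norms of the e_i have a bounded sum ([summable_components]).  Indeed K is
      bounded below on components, by lam^n - eta.  A finite net of the image of
      the unit ball under K sorts the e_i into finitely many classes, and on each
      class the vectors K e_i are almost parallel, so that their norms nearly add
      up to the norm of K at a partial sum, which is bounded.
    - Since x' has no atoms, such sums being bounded forces x' to split into
      disjoint components that are all of small norm
      ([fine_partition_exists]).
    - Let P_i be the band projection onto e_i.  Averaging over signs,
      the norm of the sum of the P_i (S - K) e_i is at most eta times that of x'
      ([vnorm_pinch]), whereas the sum of the P_i S e_i dominates lam^n x'.  So the
      sum of the P_i K e_i is bounded away from 0 ([pinch_lower_bound]).  When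
      the e_i are small, compactness of K makes that sum small: K e_i is close to
      |e_i| y for one of finitely many y, and the P_i are disjoint
      ([pinch_upper_bound]).

    All estimates compare norms of lattice elements; functionals do not occur. *)

Set Implicit Arguments.
Unset Strict Implicit.
Unset Printing Implicit Defensive.

Import Order.TTheory GRing.Theory Num.Theory.
Import numFieldNormedType.Exports.

Local Open Scope classical_set_scope.
Local Open Scope ring_scope.

(** * Disjointness *)

Section Disjointness.
Context {R : realType} {V : vectorLatticeType R}.
Implicit Types (u v w x y z : V) (S : set V).

Lemma vdisjoint_sym x y : vdisjoint x y -> vdisjoint y x.
Proof. by move=> /vdisjointP d; apply/vdisjointP => z z0 zy zx; exact: d. Qed.

Lemma vdisjoint_le u v x y : vdisjoint x y -> vabs u <= vabs x ->
  vabs v <= vabs y -> vdisjoint u v.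
Proof.
move=> /vdisjointP d ux vy; apply/vdisjointP => z z0 zu zv.
by apply: d => //; [exact: le_trans ux|exact: le_trans vy].
Qed.

Lemma vdisjoint_posP x y : 0 <= x -> 0 <= y -> vdisjoint x y <->
  forall z, 0 <= z -> z <= x -> z <= y -> z = 0.
Proof. by move=> x0 y0; split=> [/vdisjointP|d]; [|apply/vdisjointP];
  rewrite ?vabs_id. Qed.

Lemma vdisjoint_lel u x y : vdisjoint x y -> 0 <= u -> u <= x -> vdisjoint u y.
Proof.
move=> d u0 ux; apply: (vdisjoint_le d) => //.
by rewrite !vabs_id//; exact: le_trans ux.
Qed.

Lemma vdisjointxx x : vdisjoint x x -> x = 0.
Proof.
by move=> /vdisjointP d; apply: vabs_eq0; apply: d; rewrite ?vabs_ge0.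
Qed.

Lemma vdisjoint0x x : vdisjoint 0 x.
Proof.
apply/vdisjointP => z z0; rewrite vabs_id// => z_le0 _.
by apply/le_anti; rewrite z0 z_le0.
Qed.

Lemma supremums_set0 x : supremums set0 x -> x = 0.
Proof.
move=> [_ x_le]; have {}x_le z : x <= z by exact: x_le.
apply/le_anti; rewrite x_le/=.
by have := x_le (x + x); rewrite -vlerBlDr subrr.
Qed.

(** The part of z below x given by the Riesz decomposition lies below both z and
    x, so it vanishes. *)
Lemma vle_disjointD x y z : 0 <= x -> 0 <= y -> 0 <= z ->
  z <= x + y -> vdisjoint z x -> z <= y.
Proof.
move=> x0 y0 z0 zxy /(vdisjoint_posP z0 x0) d.
have [z1 [z2 [/andP[z10 z1x] /andP[z20 z2y] ez]]] :=
  riesz_decomposition x0 y0 z0 zxy.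
by rewrite ez (d z1)// ?add0r// ez vlerDl.
Qed.

Lemma vle_addD x y z : 0 <= x -> 0 <= y -> x <= z -> y <= z ->
  vdisjoint x y -> x + y <= z.
Proof.
move=> x0 y0 xz yz d; rewrite -vlerBrDr; apply: (@vle_disjointD y) => //.
- by rewrite vsubr_ge0.
- by rewrite addrC subrK.
Qed.

Lemma vdisjoint_posN x : vdisjoint (vpos x) (vpos (- x)).
Proof.
apply/vdisjoint_posP; rewrite ?vpos_ge0// => z z0 zp zn.
apply/le_anti; rewrite z0 andbT.
have : vpos x <= vpos x - z.
  by rewrite vjoin_le vsubr_ge0 zp andbT -[X in X <= _](vposB x) vlerD// vlerN2.
by rewrite vlerBrDr addrC -vlerBrDr subrr.
Qed.

Lemma vabs_posD x : vabs x = vpos x + vpos (- x).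
Proof.
apply/le_anti/andP; split.
  rewrite vabs_le; apply/andP; split.
    by rewrite (le_trans (vpos_ge x))// vlerDl ?vpos_ge0.
  by rewrite (le_trans (vpos_ge (- x)))// vlerDr ?vpos_ge0.
apply: vle_addD; rewrite ?vpos_ge0//; last exact: vdisjoint_posN.
- by rewrite vjoin_le vabs_ge vabs_ge0.
- by rewrite vjoin_le vabs_geN vabs_ge0.
Qed.

Lemma vpos_le_abs x : vpos x <= vabs x.
Proof. by rewrite vabs_posD vlerDl ?vpos_ge0. Qed.

(** For closure under suprema: if z lies below both s - a0 and |y|, then s - z is
    still an upper bound, because each (a - a0)^+ is disjoint from z and so adds
    to it inside s - a0. *)
Lemma disjoint_compl_band S : is_band (disjoint_compl S).
Proof.
split=> [|A s AS [sub slub] y Sy].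
  split=> [y Sy|a x y dx dy|x y dy xy z Sz].
  - exact: vdisjoint0x.
  - exact: disjoint_compl_lin.
  - exact: vdisjoint_le (dy _ Sz) xy _.
have [A0|/set0P[a0 Aa0]] := eqVneq A set0; last first.
  have ta0 : vdisjoint (s - a0) y.
    have t0 : 0 <= s - a0 by rewrite vsubr_ge0; exact: sub.
    apply/vdisjointP => z z0; rewrite vabs_id// => zt zy.
    apply/le_anti; rewrite z0 andbT -(vlerD2rE (s - z)) addrC subrK add0r.
    apply: slub => a Aa; rewrite -(vlerD2rE (- a0)).
    apply: le_trans (vpos_ge _) _; rewrite addrAC vlerBrDr.
    apply: vle_addD; rewrite ?vpos_ge0//.
      by rewrite vjoin_le t0 andbT vlerD2r//; exact: sub.
    apply: (@vdisjoint_le _ _ (a - a0) y).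
    - have := @disjoint_compl_lin _ _ S (- 1) _ _ (AS _ Aa0) (AS _ Aa).
      by rewrite scaleN1r addrC; apply.
    - by rewrite [X in X <= _]vabs_id ?vpos_ge0// vpos_le_abs.
    - by rewrite (vabs_id z0).
  have := @disjoint_compl_lin _ _ [set y] 1 (s - a0) a0.
  by rewrite scale1r subrK; apply=> //= _ ->//; exact: AS.
rewrite (@supremums_set0 s); first exact: vdisjoint0x.
by split=> [?|z _] //; apply: slub => a; rewrite A0.
Qed.

Lemma positive_le (L : {linear V -> V}) x y : positive_map L -> x <= y ->
  L x <= L y.
Proof. by move=> L0 xy; rewrite -vsubr_ge0 -linearB L0// vsubr_ge0. Qed.

End Disjointness.

(** * Band projections *)

Section BandProjections.
Context {R : realType} {V : ocVectorLatticeType R}.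
Implicit Types (B : set V) (e f v w x y z : V).

Section FixedBand.
Variables (B : set V) (bB : is_band B).
Local Notation P := (band_proj B).

Lemma band_projD x y : P (x + y) = P x + P y.
Proof. by have := band_proj_linear bB 1 x y; rewrite !scale1r. Qed.

Lemma band_projB x y : P (x - y) = P x - P y.
Proof. by apply/eqP; rewrite eq_sym subr_eq -band_projD subrK. Qed.

Lemma band_proj_in x : B (P x).
Proof. exact: (band_proj_spec bB x).1. Qed.

Lemma band_proj_compl x : disjoint_compl B (x - P x).
Proof. exact: (band_proj_spec bB x).2. Qed.

Lemma band_proj_id x : B x -> P x = x.
Proof.
move=> Bx; apply: (band_projE bB) => //; rewrite subrr => y _.
exact: vdisjoint0x.
Qed.

Lemma band_proj_eq0 x : disjoint_compl B x -> P x = 0.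
Proof. by move=> dx; apply: (band_projE bB); [exact: band0|rewrite subr0]. Qed.

Lemma band_proj_subK x : P (x - P x) = 0.
Proof. exact/band_proj_eq0/band_proj_compl. Qed.

Lemma band_proj_idem x : P (P x) = P x.
Proof. exact/band_proj_id/band_proj_in. Qed.

(** The negative part of x - P x lies below P x, from which x - P x is disjoint. *)
Lemma band_proj_le x : 0 <= x -> P x <= x.
Proof.
move=> x0; rewrite -vsubr_ge0 -(vposB (x - P x)).
suff -> : vpos (- (x - P x)) = 0 by rewrite subr0 vpos_ge0.
have /vdisjointP := band_proj_compl x (band_proj_in x).
apply; rewrite ?vpos_ge0//; first by rewrite -vabsN vpos_le_abs.
rewrite opprB vabs_id ?(band_proj_ge0 bB)// vjoin_le.
by rewrite (band_proj_ge0 bB)// andbT vlerBlDr vlerDl.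
Qed.

Lemma band_proj_sub_ge0 x : 0 <= x -> 0 <= x - P x.
Proof. by move=> x0; rewrite vsubr_ge0 band_proj_le. Qed.

Lemma band_proj_mono x y : x <= y -> P x <= P y.
Proof.
by move=> xy; rewrite -vsubr_ge0 -band_projB (band_proj_ge0 bB)// vsubr_ge0.
Qed.

Lemma band_proj_sub_mono x y : x <= y -> x - P x <= y - P y.
Proof.
move=> xy; rewrite -vsubr_ge0.
have -> : y - P y - (x - P x) = y - x - P (y - x).
  by rewrite band_projB !opprB addrACA [RHS]addrACA [- x - _]addrC.
by rewrite band_proj_sub_ge0// vsubr_ge0.
Qed.

Lemma abs_band_proj_mono x : vabs (P x) <= P (vabs x).
Proof.
rewrite vabs_le band_proj_mono ?vabs_ge//=.
have := band_proj_mono (vabs_geN x).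
by rewrite -[- x]sub0r band_projB (band_proj_id (band0 bB)) sub0r.
Qed.

Lemma abs_band_proj_le x : vabs (P x) <= vabs x.
Proof.
apply: le_trans (abs_band_proj_mono x) _.
exact/band_proj_le/vabs_ge0.
Qed.

Lemma band_proj_disjoint x y : vdisjoint (P x) (y - P y).
Proof. exact/vdisjoint_sym/band_proj_compl/band_proj_in. Qed.

End FixedBand.

(** The double disjoint complement of e is the band generated by e. *)
Definition proj e : V -> V :=
  band_proj (disjoint_compl (disjoint_compl [set e])).

Let bdd e := disjoint_compl_band (disjoint_compl [set e]).

Lemma projD e x y : proj e (x + y) = proj e x + proj e y.
Proof. exact: band_projD (bdd e) x y. Qed.

Lemma projB e x y : proj e (x - y) = proj e x - proj e y.
Proof. exact: band_projB (bdd e) x y. Qed.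

Lemma proj0 e : proj e 0 = 0.
Proof. by have := projB e 0 0; rewrite !subrr. Qed.

Lemma projZ e (a : R) x : proj e (a *: x) = a *: proj e x.
Proof.
have := band_proj_linear (bdd e) a x 0; rewrite -/(proj e) addr0 => h.
by rewrite [LHS]h proj0 addr0.
Qed.

Lemma proj_ge0 e x : 0 <= x -> 0 <= proj e x.
Proof. exact: (band_proj_ge0 (bdd e)). Qed.

Lemma proj_le e x : 0 <= x -> proj e x <= x.
Proof. exact: (band_proj_le (bdd e)). Qed.

Lemma proj_mono e x y : x <= y -> proj e x <= proj e y.
Proof. exact: (band_proj_mono (bdd e)). Qed.

Lemma proj_id e : proj e e = e.
Proof.
by apply: (band_proj_id (bdd e)) => y dy; exact/vdisjoint_sym/dy.
Qed.

Lemma proj_eq0 e v : vdisjoint e v -> proj e v = 0.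
Proof.
move=> d; apply: (band_proj_eq0 (bdd e)) => w dw; apply/vdisjoint_sym/dw => _ ->.
exact: vdisjoint_sym.
Qed.

Lemma proj_disjoint e v z : vdisjoint e z -> vdisjoint (proj e v) z.
Proof.
move=> d; apply: (band_proj_in (bdd e) v).
by move=> _ ->; exact: vdisjoint_sym.
Qed.

Lemma proj_proj0 e f v : vdisjoint e f -> proj e (proj f v) = 0.
Proof.
by move=> d; exact/proj_eq0/vdisjoint_sym/proj_disjoint/vdisjoint_sym.
Qed.

Lemma abs_proj_le e v : vabs (proj e v) <= proj e (vabs v).
Proof. exact: (abs_band_proj_mono (bdd e)). Qed.

End BandProjections.

(** * Orthomorphisms *)

Section Orthomorphisms.
Context {R : realType} {V : ocVectorLatticeType R}.
Implicit Types (S T U : regular_operator V) (x y z : V).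

Lemma regular_order_bounded T : order_bounded T.
Proof.
move=> a b; have /regularP[S1 [S2 [S10 S20 TE]]] := regular_funP T.
exists (S1 a - S2 b), (S1 b - S2 a) => x /andP[ax xb].
by rewrite TE /=; apply/andP; split; apply: vlerD; rewrite ?vlerN2 positive_le.
Qed.

Lemma sandwich_regular (P Q : {linear V -> V}) T :
  positive_map P -> positive_map Q -> P \o T \o Q \in @regular R V.
Proof.
move=> P0 Q0; have /regularP[S1 [S2 [S10 S20 TE]]] := regular_funP T.
apply/regularP; exists (P \o S1 \o Q), (P \o S2 \o Q).
split=> [x x0|x x0|]; rewrite /= ?P0 ?S10 ?S20 ?Q0//.
by apply/funext => x /=; rewrite TE /= linearB.
Qed.

Lemma regular_opD T x y : T (x + y) = T x + T y.
Proof. exact: linearD. Qed.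

Lemma regular_opB T x y : T (x - y) = T x - T y.
Proof. exact: linearB. Qed.

Lemma regular_op0 T : T 0 = 0.
Proof. exact: linear0. Qed.

Lemma regular_opZ T (a : R) x : T (a *: x) = a *: T x.
Proof. exact: linearZ. Qed.

Lemma regular_abs T x : vabs (T x) <= vabs T (vabs x).
Proof.
have le1 y : 0 <= y -> T y <= vabs T y.
  by move=> y0; have /regular_leP := vabs_ge T; exact.
have le2 y : 0 <= y -> - T y <= vabs T y.
  by move=> y0; have /regular_leP := vabs_geN T; exact.
rewrite -[x in T x]vposB (vabs_posD x) linearB linearD vabs_le opprB.
apply/andP; split; first by apply: vlerD; [exact/le1/vpos_ge0|exact/le2/vpos_ge0].
by rewrite addrC; apply: vlerD; [exact/le2/vpos_ge0|exact/le1/vpos_ge0].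
Qed.

Section BandPinching.
Variables (B : set V) (bB : is_band B).
Local Notation P := (linear_of (band_proj_linear bB)).
Local Notation Q := (idfun \- P).

Let P0 : positive_map P. Proof. by move=> x; exact: (band_proj_ge0 bB). Qed.
Let Q0 : positive_map Q.
Proof. by move=> x x0 /=; exact: (band_proj_sub_ge0 bB). Qed.

Definition pinching T : regular_operator V :=
  RegularOperator (sandwich_regular T P0 P0) +
  RegularOperator (sandwich_regular T Q0 Q0).

Lemma pinchingE T x : pinching T x = band_proj B (T (band_proj B x)) +
  (T (x - band_proj B x) - band_proj B (T (x - band_proj B x))).
Proof. by []. Qed.

End BandPinching.

(** Applied to a band and to its disjoint complement, invariance gives
    commutation with the band projection. *)
Lemma orthomorphismsE T : orthomorphisms T <->
  forall (B : set V), is_band B ->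
    forall x, T (band_proj B x) = band_proj B (T x).
Proof.
split=> [[_ TB] B bB x|TP].
  have TPx : band_proj B (T (band_proj B x)) = T (band_proj B x).
    by apply: (band_proj_id bB); apply: (TB _ bB); exact: band_proj_in.
  have TQx : band_proj B (T (x - band_proj B x)) = 0.
    apply: (band_proj_eq0 bB); apply: (TB _ (disjoint_compl_band B)).
    exact: band_proj_compl.
  by rewrite -[x in RHS](subrK (band_proj B x)) regular_opD (band_projD bB) TQx
    add0r TPx.
split=> [|B bB x Bx]; first exact: regular_order_bounded.
by rewrite -(band_proj_id bB Bx) TP//; exact: band_proj_in.
Qed.

Lemma pinching_orth T (B : set V) (bB : is_band B) :
  orthomorphisms T -> pinching bB T = T.
Proof.
move=> /orthomorphismsE TP; apply: regular_ext => x _; rewrite pinchingE.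
by rewrite regular_opB !TP// band_proj_idem// band_proj_subK// subr0 addrC subrK.
Qed.

Lemma pinching_le S T (B : set V) (bB : is_band B) : S <= T ->
  pinching bB S <= pinching bB T.
Proof.
move=> /regular_leP ST; apply/regular_leP => x x0.
rewrite !pinchingE vlerD//.
  by rewrite band_proj_mono// ST// (band_proj_ge0 bB).
set y := x - _; have y0 : 0 <= y by exact: band_proj_sub_ge0.
by rewrite band_proj_sub_mono// ST.
Qed.

(** For y >= 0 in a band with projection P, the hypotheses give
    T y <= P (T y), so T y - S y equals its component in the band.  Any least
    upper bound of operators fixed by pinching is dominated by its own pinchings,
    which is how moduli and suprema of orthomorphisms are handled below. *)
Lemma pinching_dominated S T :
  orthomorphisms S -> S <= T ->
  (forall B (bB : is_band B), T <= pinching bB T) -> orthomorphisms T.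
Proof.
move=> oS /regular_leP ST Tpinch; split=> [|B bB x Bx].
  exact: regular_order_bounded.
have [_ SB] := oS.
suff pos y : 0 <= y -> B y -> B (T y).
  have Bp z : B z -> B (vpos z).
    move=> Bz; apply: (band_solid bB Bz).
    by rewrite vabs_id ?vpos_ge0 ?vpos_le_abs.
  rewrite -(vposB x) regular_opB; apply: (bandB bB); apply: pos;
    rewrite ?vpos_ge0//; apply: Bp => //.
  by rewrite -[x]scale1r -scaleNr; exact: (bandZ bB).
move=> y0 By.
have /regular_leP/(_ _ y0) := Tpinch _ bB.
rewrite pinchingE (band_proj_id bB By) subrr regular_op0.
rewrite (band_proj_id bB (band0 bB)) subrr addr0 => TPT.
have TS : T y - S y = band_proj B (T y - S y).
  apply/le_anti/andP; split; last by rewrite band_proj_le// vsubr_ge0 ST.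
  rewrite band_projB// [band_proj B (S y)](band_proj_id bB (SB _ bB _ By)).
  by rewrite vlerD2r.
rewrite -(subrK (S y) (T y)); apply: (bandD bB); last exact: SB.
by rewrite TS; exact: band_proj_in.
Qed.

Lemma orthomorphisms_lin (a : R) S T : orthomorphisms S -> orthomorphisms T ->
  orthomorphisms (a *: S + T).
Proof.
move=> [_ SB] [_ TB]; split; first exact: regular_order_bounded.
by move=> B bB x Bx; apply: (band_lin bB); [exact: SB|exact: TB].
Qed.

Lemma orthomorphisms0 : orthomorphisms (0 : regular_operator V).
Proof.
split; first exact: regular_order_bounded.
by move=> B bB x _; exact: (band0 bB).
Qed.

Lemma orthomorphisms_abs T : orthomorphisms T -> orthomorphisms (vabs T).
Proof.
move=> oT; apply: (pinching_dominated oT); first exact: vabs_ge.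
move=> B bB; have oNT : orthomorphisms (- T).
  by have := orthomorphisms_lin (- 1) oT orthomorphisms0; rewrite scaleN1r addr0.
rewrite vabs_le -{1}(pinching_orth bB oT) -{1}(pinching_orth bB oNT).
by rewrite !pinching_le ?vabs_ge ?vabs_geN.
Qed.

Lemma orthomorphisms_solid S T : orthomorphisms T -> vabs S <= vabs T ->
  orthomorphisms S.
Proof.
move=> /orthomorphisms_abs[_ TB] /regular_leP ST; split.
  exact: regular_order_bounded.
move=> B bB x Bx; have Bax := band_vabs bB Bx.
apply: (band_solid bB (TB _ bB _ Bax)).
apply: (le_trans (regular_abs S x)); apply: le_trans (ST _ (vabs_ge0 x)) _.
exact: vabs_ge.
Qed.

(** This is what makes [op_diagonal] the component in a genuine projection
    band. *)
Lemma orthomorphisms_band : is_band (@orthomorphisms R V).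
Proof.
split=> [|A s AO [sub slub]].
  split=> [|a S T oS oT|S T oT]; [exact: orthomorphisms0|
    exact: orthomorphisms_lin|exact: orthomorphisms_solid].
have [A0|/set0P[a0 Aa0]] := eqVneq A set0; last first.
  apply: (@pinching_dominated a0) => [||B bB]; [exact: AO|exact: sub|].
  apply: slub => a Aa; rewrite -(pinching_orth bB (AO _ Aa)).
  by apply: pinching_le; exact: sub.
rewrite (@supremums_set0 _ _ s); first exact: orthomorphisms0.
by split=> [?|z _] //; apply: slub => a; rewrite A0.
Qed.

End Orthomorphisms.

(** * Diagonals of compressions *)

Section OrthomorphismDisjointness.
Context {R : realType} {V : ocVectorLatticeType R}.
Implicit Types (T : regular_operator V) (x y : V).

(** Unlike invariance of bands, this characterization passes between a space and
    a band in it without comparing the bands of the two. *)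
Lemma orthomorphisms_disjointP T : orthomorphisms T <->
  forall x y, vdisjoint x y -> vdisjoint (T x) y.
Proof.
split=> [[_ TB] x y xy|dT].
  have /(_ x) := TB _ (disjoint_compl_band [set y]).
  by apply=> // _ ->.
split=> [|B bB x Bx]; first exact: regular_order_bounded.
have dc := band_proj_compl bB (T x).
suff d0 : T x - band_proj B (T x) = 0.
  by rewrite -[T x](subrK (band_proj B (T x))) d0 add0r; exact: band_proj_in.
apply: vdisjointxx.
have := @disjoint_compl_lin _ _ [set T x - band_proj B (T x)] (- 1)
  (band_proj B (T x)) (T x); rewrite scaleN1r [- _ + _]addrC.
apply=> // _ ->; first by apply: band_proj_disjoint.
by apply: dT; apply/vdisjoint_sym/dc.
Qed.

Lemma op_diagonal_orth T : orthomorphisms (op_diagonal T).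
Proof. exact: (band_proj_in orthomorphisms_band). Qed.

Lemma op_diagonal_ge0 T : 0 <= T -> 0 <= op_diagonal T.
Proof. exact: (band_proj_ge0 orthomorphisms_band). Qed.

Lemma op_diagonal_le T : 0 <= T -> op_diagonal T <= T.
Proof. exact: (band_proj_le orthomorphisms_band). Qed.

End OrthomorphismDisjointness.

Section BandSpaces.
Context {R : realType} {V : ocVectorLatticeType R} (B : band V).
Implicit Types (T : regular_operator V) (x y : V).
Let bB := bandP B.

Lemma band_val_disjoint (a b : band_space B) :
  vdisjoint a b <-> vdisjoint (band_val a) (band_val b).
Proof. by split=> [/(congr1 band_val)//|h]; apply/val_inj. Qed.

Lemma compression_orth T : orthomorphisms T -> orthomorphisms (compression B T).
Proof.
move=> /orthomorphisms_disjointP oT; apply/orthomorphisms_disjointP => a b.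
move=> /band_val_disjoint/oT ab; apply/band_val_disjoint.
by apply: (vdisjoint_le ab); [exact: abs_band_proj_le|exact: lexx].
Qed.

Lemma band_extension_orth (Z : regular_operator (band_space B)) :
  orthomorphisms Z -> orthomorphisms (band_extension Z).
Proof.
move=> /orthomorphisms_disjointP oZ; apply/orthomorphisms_disjointP => x y xy.
have d1 : vdisjoint (band_val (band_corestrict B x))
    (band_val (band_corestrict B y)).
  by apply: (vdisjoint_le xy); exact: abs_band_proj_le.
move/band_val_disjoint : d1 => /oZ/band_val_disjoint d1.
have d2 : vdisjoint (band_extension Z x) (y - band_proj B y).
  exact/vdisjoint_sym/(band_proj_compl bB)/band_valB.
have := @disjoint_compl_lin _ _ [set band_extension Z x] 1
  (y - band_proj B y) (band_proj B y).
rewrite scale1r subrK => h; apply/vdisjoint_sym/h => // _ ->;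
  exact: vdisjoint_sym.
Qed.

Lemma band_corestrict_val (a : band_space B) :
  band_corestrict B (band_val a) = a.
Proof. by apply/val_inj/(band_proj_id bB)/band_valB. Qed.

(** By uniqueness of the decomposition it suffices that the compression of T - D
    is disjoint from the orthomorphisms of B.  An orthomorphism of B between 0 and
    that compression extends by 0 to an orthomorphism below T - D, hence
    vanishes. *)
Lemma compression_diagonal T : 0 <= T ->
  op_diagonal (compression B T) = compression B (op_diagonal T).
Proof.
move=> T0; set D := op_diagonal T.
apply: (band_projE orthomorphisms_band).
  exact/compression_orth/op_diagonal_orth.
have TD : compression B T - compression B D = compression B (T - D).
  by apply: regular_ext => a _; apply/val_inj; rewrite /= -band_projB.
rewrite TD => G oG; apply/vdisjointP => Z Z0.
have /regular_leP TD0 : 0 <= T - D by rewrite vsubr_ge0 op_diagonal_le.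
rewrite vabs_id; last first.
  apply/regular_leP => a a0; apply: (band_proj_ge0 bB); exact: TD0.
move=> /regular_leP ZT ZG.
have oZ : orthomorphisms Z by apply: (orthomorphisms_solid oG); rewrite vabs_id.
have : vdisjoint (T - D) (band_extension Z).
  apply: (band_proj_compl orthomorphisms_band T); exact: band_extension_orth.
have Z'0 : 0 <= band_extension Z.
  apply/regular_leP => x x0; move/regular_leP: Z0 => /(_ (band_corestrict B x)).
  by apply; exact: band_corestrict_ge0.
move=> /vdisjointP/(_ _ Z'0); rewrite (vabs_id Z'0) lexx => Z'E.
apply: regular_ext => a a0; apply/val_inj.
have ZE : band_val (Z a) = band_extension Z (band_val a).
  by rewrite /= band_corestrict_val.
rewrite [LHS]ZE Z'E// vabs_id; last exact/regular_leP.
apply/regular_leP => x x0.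
have Px0 := band_corestrict_ge0 B x0.
have Zle : band_val (Z (band_corestrict B x)) <=
  band_proj B ((T - D) (band_proj B x)) := ZT _ Px0.
apply: le_trans Zle _; apply: le_trans (band_proj_le bB (TD0 _ _)) _ => //.
rewrite -vsubr_ge0 -regular_opB; apply: TD0.
exact: (band_proj_sub_ge0 bB).
Qed.

Lemma band_diagonal_eq T : 0 <= T ->
  (forall x, disjoint_compl B x -> op_diagonal T x = 0) ->
  op_diagonal T = band_diagonal B T.
Proof.
move=> T0 D0; rewrite /band_diagonal compression_diagonal//.
have /orthomorphismsE oD := op_diagonal_orth T.
apply: regular_ext => x _; rewrite /= -oD// band_proj_idem//.
rewrite -[x in LHS](subrK (band_proj B x)) regular_opD D0 ?add0r//.
exact: band_proj_compl.
Qed.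

End BandSpaces.

(** * Components and lower bounds for orthomorphisms *)

Section Components.
Context {R : realType} {V : ocVectorLatticeType R}.
Implicit Types (e x : V).

Definition component x e := [/\ 0 <= e, e <= x & vdisjoint e (x - e)].

Lemma component_proj x e : component x e -> proj e x = e.
Proof.
move=> [_ _ d]; rewrite -[x](subrK e) projD proj_id proj_eq0 ?add0r//.
Qed.

Lemma proj_component x e : 0 <= x -> component x (proj e x).
Proof.
move=> x0; split; [exact: proj_ge0|exact: proj_le|].
exact/band_proj_disjoint/disjoint_compl_band.
Qed.

Lemma component_compl x e : component x e -> component x (x - e).
Proof.
move=> [e0 ex d]; split; first by rewrite vsubr_ge0.
  by rewrite vlerBlDr vlerDl.
by rewrite subKr; exact: vdisjoint_sym.
Qed.

Lemma component_refl x : 0 <= x -> component x x.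
Proof.
by move=> x0; split=> //; rewrite subrr; exact/vdisjoint_sym/vdisjoint0x.
Qed.

Lemma component_trans x y z : component x y -> component y z -> component x z.
Proof.
move=> [y0 yx dxy] [z0 zy dyz]; split=> //; first exact: le_trans yx.
have xy0 : 0 <= x - y by rewrite vsubr_ge0.
have yz0 : 0 <= y - z by rewrite vsubr_ge0.
have xz0 : 0 <= x - z by rewrite vsubr_ge0 (le_trans zy).
apply/vdisjoint_posP => // w w0 wz wx.
apply: (proj1 (vdisjoint_posP z0 yz0) dyz) => //.
apply: (@vle_disjointD _ _ (x - y)) => //; first by rewrite addrA subrK.
by apply: (vdisjoint_lel dxy) => //; exact: le_trans zy.
Qed.

Lemma component_sub x e f : component x e -> component e f ->
  vdisjoint f (x - e).
Proof. by move=> [_ _ d] [f0 fe _]; exact: vdisjoint_lel d f0 fe. Qed.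

End Components.

Section LowerBound.
Context {R : realType} {E : ocBanachLatticeType R}.
Implicit Types (x e : E) (D : regular_operator E).

Lemma orthomorphism_proj D e x : orthomorphisms D ->
  D (proj e x) = proj e (D x).
Proof. by move=> /orthomorphismsE; apply; exact: disjoint_compl_band. Qed.

(** By the Archimedean property, D x <= lam x fails for some lam > 0.  In the band
    generated by the positive part u of D x - lam x, the component x' of x
    satisfies D x' = u + lam x', and this relation is inherited by the components
    of x' because D commutes with band projections. *)
Lemma orthomorphism_lower_bound D x : 0 <= D -> orthomorphisms D -> 0 <= x ->
  D x != 0 -> exists2 lam : R, 0 < lam &
  exists x', [/\ 0 <= x', x' <= x, x' != 0 &
    forall e, component x' e -> lam *: e <= D e].
Proof.
move=> /regular_leP D0 oD x0 Dx0.
have [lam lam0 Dlam] : exists2 lam : R, 0 < lam & ~~ (D x <= lam *: x).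
  apply: contrapT => /forall2NP h; move/negP: Dx0; apply.
  have Dx_le lam : 0 < lam -> vnorm (D x) <= lam * vnorm x.
    move=> l0; rewrite -[lam]gtr0_norm// -vnormZ vnorm_le ?D0//.
    by have [//|/negP/negPn] := h lam.
  apply/eqP/vnorm0_eq0/le_anti/andP; split; last first.
    by rewrite -(@vnorm0 _ E) vnorm_le// D0.
  have nx0 : 0 <= vnorm x by rewrite -(@vnorm0 _ E) vnorm_le.
  have nx1 : 0 < vnorm x + 1 by rewrite ltr_wpDl.
  apply/ler_addgt0Pl => e e0; rewrite addr0.
  apply: le_trans (Dx_le (e / (vnorm x + 1)) _) _; first exact: divr_gt0.
  by rewrite -mulrA ger_pMr// mulrC ler_pdivrMr// mul1r lerDl.
exists lam => //; set w := D x - lam *: x; set u := vpos w.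
have u0 : 0 <= u by exact: vpos_ge0.
have u_neq0 : u != 0.
  apply: contra Dlam => /eqP u_eq0; rewrite -(vlerD2rE (- (lam *: x))) subrr.
  by rewrite -/w -u_eq0 vpos_ge.
have Pw : proj u w = u.
  rewrite -{1}(vposB w) -/u projB proj_id proj_eq0 ?subr0//.
  exact: vdisjoint_posN.
have DPx : D (proj u x) = u + lam *: proj u x.
  rewrite orthomorphism_proj// -projZ -{2}Pw -projD /w subrK//.
exists (proj u x); split; rewrite ?proj_ge0 ?proj_le//.
  apply: contraNneq u_neq0 => Px0.
  by move: DPx; rewrite Px0 regular_op0 scaler0 addr0 => <-.
move=> e ce; rewrite -{2}(component_proj ce) orthomorphism_proj// DPx.
by rewrite projD projZ (component_proj ce) vlerDr// proj_ge0.
Qed.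

End LowerBound.

(** * Disjoint partitions *)

Section Partitions.
Context {R : realType} {V : ocVectorLatticeType R}.
Implicit Types (a b e f v x : V) (es fs : seq V).

Fixpoint disjoint_seq es : Prop := if es is e :: es'
  then [/\ 0 <= e, forall f, f \in es' -> vdisjoint e f & disjoint_seq es']
  else True.

Definition disjoint_partition x es := disjoint_seq es /\ \sum_(e <- es) e = x.

Lemma disjoint_sum e es : (forall f, f \in es -> vdisjoint e f) ->
  vdisjoint e (\sum_(f <- es) f).
Proof.
move=> d; rewrite big_seq; apply: (big_ind (vdisjoint e)) => //.
- exact/vdisjoint_sym/vdisjoint0x.
- move=> x y dx dy; have := @disjoint_compl_lin _ _ [set e] 1 x y.
  by rewrite scale1r => h; apply/vdisjoint_sym/h => // _ ->; exact: vdisjoint_sym.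
Qed.

Lemma disjoint_seq_component es e : disjoint_seq es -> e \in es ->
  component (\sum_(f <- es) f) e.
Proof.
elim: es e => // f es IH e [f0 df des]; rewrite inE big_cons.
have sum0 : 0 <= \sum_(f <- es) f.
  rewrite big_seq; apply: (big_ind (fun x => 0 <= x)) => //; first exact: vaddr_ge0.
  by move=> g ges; case: (IH g des ges).
case/predU1P => [->|ees].
  split; rewrite ?vlerDl//; rewrite [f + _]addrC addrK; exact: disjoint_sum.
have [e0 ele de] := IH _ des ees; split=> //.
  by rewrite (le_trans ele)// vlerDr.
have := @disjoint_compl_lin _ _ [set e] 1 f (\sum_(g <- es) g - e).
rewrite scale1r addrA => h; apply/vdisjoint_sym/h => // _ ->.
  exact: df.
exact: vdisjoint_sym.
Qed.

Lemma disjoint_partition_component x es e : disjoint_partition x es -> e \in es ->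
  component x e.
Proof. by move=> [des <-]; exact: disjoint_seq_component. Qed.

Lemma disjoint_seq_cat es fs : disjoint_seq es -> disjoint_seq fs ->
  (forall e f, e \in es -> f \in fs -> vdisjoint e f) ->
  disjoint_seq (es ++ fs).
Proof.
elim: es => //= e es IH [e0 de des] dfs d; split=> //.
  move=> f; rewrite mem_cat => /orP[/de//|]; apply: d; exact: mem_head.
by apply: IH => // f g fes; apply: d; rewrite inE fes orbT.
Qed.

Lemma disjoint_partition_cat a b es fs : vdisjoint a b ->
  disjoint_partition a es -> disjoint_partition b fs ->
  disjoint_partition (a + b) (es ++ fs).
Proof.
move=> dab pa pb; split; last by rewrite big_cat/= pa.2 pb.2.
apply: disjoint_seq_cat; [exact: pa.1|exact: pb.1|move=> e f ees ffs].
have [e0 ea _] := disjoint_partition_component pa ees.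
have [f0 fb _] := disjoint_partition_component pb ffs.
apply: (vdisjoint_lel _ e0 ea); apply: vdisjoint_sym.
by apply: (vdisjoint_lel _ f0 fb); exact: vdisjoint_sym.
Qed.

Lemma proj_sum (I : Type) (s : seq I) (F : I -> V) e :
  proj e (\sum_(i <- s) F i) = \sum_(i <- s) proj e (F i).
Proof. exact: (big_morph _ (projD e) (proj0 e)). Qed.

Lemma proj_proj_sum0 e es v : (forall f, f \in es -> vdisjoint e f) ->
  proj e (\sum_(f <- es) proj f v) = 0.
Proof.
by move=> d; rewrite proj_sum big_seq big1// => f fes; rewrite proj_proj0//; exact: d.
Qed.

(** One more disjoint projection only sees the residue v - \sum proj e v. *)
Lemma proj_sum_le es v : disjoint_seq es -> 0 <= v ->
  \sum_(e <- es) proj e v <= v.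
Proof.
move=> + v0; elim: es => [|e es IH]; first by rewrite big_nil.
move=> [e0 de /IH{}IH]; rewrite big_cons.
rewrite -vlerBrDr.
have -> : proj e v = proj e (v - \sum_(f <- es) proj f v).
  by rewrite projB proj_proj_sum0// subr0.
by rewrite proj_le// vsubr_ge0.
Qed.

End Partitions.

(** * Pinching along a partition *)

Section Pinching.
Context {R : realType} {E : ocBanachLatticeType R}.
Implicit Types (e v : E) (es : seq E).

Definition reflection e v : E := v - (proj e v + proj e v).

Lemma reflectionB e v w : reflection e (v - w) = reflection e v - reflection e w.
Proof.
rewrite /reflection projB addrACA -opprD !opprB addrACA [RHS]addrACA.
by rewrite [- w - _]addrC.
Qed.

Lemma reflection_le e v : 0 <= v -> reflection e v <= v.
Proof. by move=> v0; rewrite vlerBlDr vlerDl// vaddr_ge0// proj_ge0. Qed.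

Lemma reflection_ge e v : 0 <= v -> - v <= reflection e v.
Proof.
by move=> v0; rewrite vlerBrDr addrC vlerBlDr vlerD// proj_le.
Qed.

Lemma vnorm_reflection e v : vnorm (reflection e v) <= vnorm v.
Proof.
apply: le_vnorm; rewrite -{1}(vposB v) reflectionB (vabs_posD v) vabs_le.
have Up := reflection_le e (vpos_ge0 v); have Un := reflection_le e (vpos_ge0 (- v)).
have Lp := reflection_ge e (vpos_ge0 v); have Ln := reflection_ge e (vpos_ge0 (- v)).
have NLp : - reflection e (vpos v) <= vpos v by rewrite -vlerN2 opprK.
have NLn : - reflection e (vpos (- v)) <= vpos (- v) by rewrite -vlerN2 opprK.
move: (reflection e _) (reflection e _) Up Un NLp NLn {Lp Ln} => x y Up Un NLp NLn.
by rewrite opprD opprK; apply/andP; split; exact: vlerD.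
Qed.

Definition residue es v : E := v - \sum_(e <- es) proj e v.

(** The residue completes the projections to a partition of the identity, so that
    elements can be added to the sequence one at a time. *)
Definition pinch es (R : E -> E) v : E :=
  \sum_(e <- es) proj e (R (proj e v)) + residue es (R (residue es v)).

Lemma residueB es v w : residue es (v - w) = residue es v - residue es w.
Proof.
rewrite /residue (eq_bigr (fun e => proj e v - proj e w)); last first.
  by move=> e _; rewrite projB.
by rewrite sumrB !opprB addrACA [RHS]addrACA [- w - _]addrC.
Qed.

Lemma residue_cons e es v : residue (e :: es) v = residue es v - proj e v.
Proof. by rewrite /residue big_cons opprD addrA addrAC. Qed.

Lemma vnormDD (v : E) : vnorm (v + v) = vnorm v *+ 2.
Proof.
by rewrite -mulr2n -(scaler_nat 2 v) vnormZ ger0_norm ?ler0n// mulr_natl.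
Qed.

Section PinchStep.
Variables (L : {linear E -> E}) (e : E) (es : seq E).
Hypothesis de : forall f, f \in es -> vdisjoint e f.

Let proj_residue v : proj e (residue es v) = proj e v.
Proof. by rewrite projB proj_proj_sum0// subr0. Qed.

Let residue_proj v : residue es (proj e v) = proj e v.
Proof.
rewrite /residue big_seq big1 ?subr0// => f fes.
by rewrite proj_proj0//; exact/vdisjoint_sym/de.
Qed.

Let projf_reflection f v : f \in es -> proj f (reflection e v) = proj f v.
Proof.
move=> fes; rewrite projB projD proj_proj0 ?addr0 ?subr0//.
exact/vdisjoint_sym/de.
Qed.

Let zmod_identity (A b c d g : E) :
  g + A + (b - d - (c - g)) + (g + A + (b - d - (c - g))) =
  A + b + (A + (b - d - d) - ((c - g - g) + (c - g - g))).
Proof.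
have -> : g + A + (b - d - (c - g)) = A + b - d - (c - g - g).
  rewrite !opprB [g + A]addrC; move: (g - c) => k; rewrite -!addrA.
  by congr (_ + _); rewrite addrCA; congr (_ + _); rewrite addrCA.
move: (c - g - g) => h.
by rewrite [LHS]addrACA [X in X + _ = _]addrACA opprD !addrA.
Qed.

(** With U = 1 - 2 P the reflection in the new band, P M P + (1 - P) M (1 - P) is
    the average of M and U M U. *)
Lemma pinchDD_cons v : pinch (e :: es) L v + pinch (e :: es) L v =
  pinch es L v + reflection e (pinch es L (reflection e v)).
Proof.
have RB x y : L (x - y) = L x - L y by exact: linearB.
have -> : pinch es L (reflection e v) =
    \sum_(f <- es) proj f (L (proj f v)) +
    (residue es (L (residue es v)) - residue es (L (proj e v)) -
     residue es (L (proj e v))).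
  rewrite /pinch; congr (_ + _).
    by rewrite big_seq [RHS]big_seq; apply: eq_bigr => f fes; rewrite projf_reflection.
  by rewrite /reflection opprD addrA !residueB residue_proj !RB !residueB.
rewrite [in RHS]/reflection.
have -> : proj e (\sum_(f <- es) proj f (L (proj f v)) +
    (residue es (L (residue es v)) - residue es (L (proj e v)) -
     residue es (L (proj e v)))) = proj e (L (residue es v)) -
     proj e (L (proj e v)) - proj e (L (proj e v)).
  rewrite projD 2!projB !proj_residue proj_sum big_seq big1 ?add0r// => f fes.
  by rewrite proj_proj0//; exact: de.
rewrite /pinch !big_cons !residue_cons RB !residueB projB.
exact: zmod_identity.
Qed.

End PinchStep.

(** Reflections preserve moduli, so each averaging step keeps the bound; the
    iterated steps amount to an average over all choices of signs on the bands. *)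
Lemma vnorm_pinch (L : {linear E -> E}) (eta : R) es : 0 <= eta ->
  (forall v, vnorm (L v) <= eta * vnorm v) -> disjoint_seq es ->
  forall v, vnorm (pinch es L v) <= eta * vnorm v.
Proof.
move=> eta0 L_eta; elim: es => [_|e es IH [_ de des]] v.
  by rewrite /pinch /residue !big_nil add0r !subr0.
rewrite -(ler_pMn2r (_ : 0 < 2)%N)// -vnormDD pinchDD_cons//.
rewrite (le_trans (vnormD _ _))// mulr2n lerD//; first exact: IH.
rewrite (le_trans (vnorm_reflection _ _))// (le_trans (IH des _))//.
by rewrite ler_wpM2l// vnorm_reflection.
Qed.

End Pinching.

(** * Summability of the norms of components *)

Section Norms.
Context {R : realType} {E : ocBanachLatticeType R}.
Implicit Types (x y v w : E).

Lemma vnorm_ge0 x : 0 <= vnorm x.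
Proof. by rewrite -vnorm_vabs -(@vnorm0 _ E) vnorm_le ?vabs_ge0. Qed.

Lemma vnormN x : vnorm (- x) = vnorm x.
Proof. by rewrite -scaleN1r vnormZ normrN1 mul1r. Qed.

Lemma vnorm_leD x y : vnorm x <= vnorm (x - y) + vnorm y.
Proof. by rewrite -{1}[x](subrK y) vnormD. Qed.

Lemma vnormZ_ge0 (a : R) x : 0 <= a -> vnorm (a *: x) = a * vnorm x.
Proof. by move=> a0; rewrite vnormZ ger0_norm. Qed.

Lemma vnorm_sum (I : Type) (s : seq I) (P : pred I) (F : I -> E) :
  vnorm (\sum_(i <- s | P i) F i) <= \sum_(i <- s | P i) vnorm (F i).
Proof.
elim/big_ind2 : _ => [|x1 x2 y1 y2 h1 h2|//]; first by rewrite vnorm0.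
by rewrite (le_trans (vnormD _ _))// lerD.
Qed.

Lemma vsum_ge0 (I : Type) (s : seq I) (P : pred I) (F : I -> E) :
  (forall i, P i -> 0 <= F i) -> 0 <= \sum_(i <- s | P i) F i.
Proof.
by move=> F0; apply: (big_ind (fun x => 0 <= x)) => // x y; exact: vaddr_ge0.
Qed.

Lemma vsum_le (I : eqType) (s : seq I) (F G : I -> E) :
  (forall i, i \in s -> F i <= G i) ->
  \sum_(i <- s) F i <= \sum_(i <- s) G i.
Proof.
move=> FG; rewrite big_seq [X in _ <= X]big_seq.
elim/big_ind2 : _ => // x1 x2 y1 y2; exact: vlerD.
Qed.

(** Total boundedness of the image of the unit ball, in homogeneous form. *)
Definition finite_net (K : E -> E) := forall e : R, 0 < e ->
  exists Y : seq E, forall v, exists2 y, y \in Y &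
    vnorm (K v - vnorm v *: y) <= e * vnorm v.

End Norms.

Section SummableComponents.
Context {R : realType} {E : ocBanachLatticeType R}.
Variables (S K : {linear E -> E}) (mu eta : R) (x : E).
Hypothesis eta_mu : eta < mu.
Hypothesis mu0 : 0 <= mu.
Hypothesis netK : finite_net K.
Hypothesis SK : forall v, vnorm (S v - K v) <= eta * vnorm v.
Hypothesis S_ge : forall e, component x e -> mu *: e <= S e.

(** If e runs over the members of a partition with K e within theta/4 |e| of
    |e| y, then w |y|, with w the sum of the norms |e|, is close to the norm of K
    at a partial sum, and (theta - theta/4) w <= w |y|.  Hence w is bounded, for
    each of the finitely many y of the net. *)
Lemma summable_components :
  exists C : R, forall es, disjoint_partition x es ->
    \sum_(e <- es) vnorm e <= C.
Proof.
pose theta := mu - eta; have theta0 : 0 < theta by rewrite subr_gt0.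
(* S expands components by mu, and K differs from S by at most eta. *)
have K_ge e : component x e -> theta * vnorm e <= vnorm (K e).
  move=> ce; have [e0 _ _] := ce.
  have : mu * vnorm e <= vnorm (S e).
    by rewrite -vnormZ_ge0// vnorm_le ?S_ge// vscaler_ge0.
  have := vnorm_leD (S e) (K e); have := SK e; rewrite /theta.
  lra.
have eps0 : 0 < theta / 4 by rewrite divr_gt0.
have [Y YP] := netK eps0.
have [M M0 KM] : exists2 M : R, 0 <= M & forall v, vnorm (K v) <= M * vnorm v.
  exists (\sum_(y <- Y) vnorm y + theta / 4) => [|v].
    by rewrite addr_ge0 ?(ltW eps0)// sumr_ge0// => y _; exact: vnorm_ge0.
  have [y yY yv] := YP v.
  have : vnorm y <= \sum_(z <- Y) vnorm z.
    by rewrite (big_rem y)//= lerDl sumr_ge0// => z _; exact: vnorm_ge0.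
  move=> /(ler_wpM2l (vnorm_ge0 v)).
  have := vnorm_leD (K v) (vnorm v *: y); rewrite vnormZ_ge0 ?vnorm_ge0//.
  move: yv; lra.
pose close y e := vnorm (K e - vnorm e *: y) <= theta / 4 * vnorm e.
exists (\sum_(y <- Y) (M * vnorm x / (theta / 2))) => es pes.
have [des sum_es] := pes.
have cover : \sum_(e <- es) vnorm e <=
    \sum_(y <- Y) \sum_(e <- es | close y e) vnorm e.
  rewrite (exchange_big_dep xpredT)//=; apply: ler_sum => e _.
  have [y yY yv] := YP e.
  rewrite (big_rem y)//= /close yv lerDl sumr_ge0// => z _; exact: vnorm_ge0.
apply: (le_trans cover); apply: ler_sum => y _.
set w := \sum_(e <- es | _) _; pose g := \sum_(e <- es | close y e) e.
have w0 : 0 <= w by rewrite sumr_ge0// => e _; exact: vnorm_ge0.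
have es0 e : e \in es -> 0 <= e.
  by move=> ees; have [] := disjoint_partition_component pes ees.
have g_le : vnorm g <= vnorm x.
  apply: vnorm_le; first by rewrite /g big_seq_cond; apply: vsum_ge0 => e /andP[/es0].
  rewrite -sum_es (bigID (close y))/= vlerDl// big_seq_cond.
  by apply: vsum_ge0 => e /andP[/es0].
have Kg : vnorm (K g - w *: y) <= theta / 4 * w.
  rewrite /g /w linear_sum scaler_suml -sumrB mulr_sumr.
  by rewrite (le_trans (vnorm_sum _ _ _))//; apply: ler_sum.
have wy : theta * w - theta / 4 * w <= w * vnorm y.
  rewrite /w -mulrBl mulr_sumr mulr_suml big_seq_cond [X in _ <= X]big_seq_cond.
  apply: ler_sum => e /andP[ees yv].
  have := K_ge _ (disjoint_partition_component pes ees).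
  have := vnorm_leD (K e) (vnorm e *: y); rewrite vnormZ_ge0 ?vnorm_ge0//.
  move: yv; rewrite /close; lra.
have wyK : w * vnorm y <= vnorm (K g) + theta / 4 * w.
  rewrite -vnormZ_ge0//; have := vnorm_leD (w *: y) (K g).
  by move=> /le_trans; apply; rewrite addrC lerD2l -vnormN opprB.
have KgM : vnorm (K g) <= M * vnorm x by rewrite (le_trans (KM _))// ler_wpM2l.
rewrite ler_pdivlMr; last by rewrite divr_gt0.
move: wy wyK KgM; lra.
Qed.

End SummableComponents.

(** * Fine partitions contradict compactness *)

Section FinePartitions.
Context {R : realType} {E : ocBanachLatticeType R}.
Variables (S K : {linear E -> E}) (mu eta C : R) (x : E).
Hypothesis eta_mu : eta < mu.
Hypothesis eta0 : 0 <= eta.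
Hypothesis netK : finite_net K.
Hypothesis SK : forall v, vnorm (S v - K v) <= eta * vnorm v.
Hypothesis S_ge : forall e, component x e -> mu *: e <= S e.
Hypothesis sum_le : forall es, disjoint_partition x es ->
  \sum_(e <- es) vnorm e <= C.

Lemma vabs_sum (I : Type) (s : seq I) (F : I -> E) :
  vabs (\sum_(i <- s) F i) <= \sum_(i <- s) vabs (F i).
Proof.
elim/big_ind2 : _ => [|x1 x2 y1 y2 h1 h2|//]; first by rewrite vabs_id.
by rewrite (le_trans (vabsD _ _))// vlerD.
Qed.

Lemma partition_proj es : disjoint_partition x es ->
  \sum_(e <- es) proj e x = x.
Proof.
move=> pes; rewrite -[RHS]pes.2 big_seq [RHS]big_seq; apply: eq_bigr => e ees.
exact: component_proj (disjoint_partition_component pes ees).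
Qed.

(** S = (S - K) + K, and pinching S - K costs at most eta. *)
Lemma pinch_lower_bound es : disjoint_partition x es -> 0 <= x ->
  (mu - eta) * vnorm x <= vnorm (\sum_(e <- es) proj e (K e)).
Proof.
move=> pes x0.
have ce e : e \in es -> component x e := disjoint_partition_component pes.
have mu0 : 0 <= mu by rewrite (le_trans eta0)// ltW.
have S_x : mu *: x <= \sum_(e <- es) proj e (S e).
  rewrite -{1}pes.2 scaler_sumr; apply: vsum_le => e ees.
  by rewrite -{1}(proj_id e) -projZ; apply/proj_mono/S_ge/ce.
have := vnorm_pinch (L := S \- K) eta0 SK pes.1 x.
have -> : pinch es (S \- K) x =
    \sum_(e <- es) proj e (S e) - \sum_(e <- es) proj e (K e).
  have [S0 K0] : S 0 = 0 /\ K 0 = 0 by split; exact: linear0.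
  rewrite /pinch /residue partition_proj// subrr /= S0 K0 subrr.
  rewrite [X in _ + (_ - X)]big1 => [|e _]; last by rewrite proj0.
  rewrite subrr addr0 -sumrB big_seq [RHS]big_seq; apply: eq_bigr => e ees.
  by rewrite (component_proj (ce _ ees)) projB.
have := vnorm_leD (\sum_(e <- es) proj e (S e)) (\sum_(e <- es) proj e (K e)).
have : mu * vnorm x <= vnorm (\sum_(e <- es) proj e (S e)).
  by rewrite -vnormZ_ge0// vnorm_le// vscaler_ge0.
lra.
Qed.

(** Writing K e = |e| f e + error with f e in a finite net, the sum of the
    |e| proj e (f e) is dominated by delta times y, where y bounds all moduli of
    the net, because disjoint projections of y add up to at most y.  The errors are
    controlled by the summability of the norms. *)
Lemma pinch_upper_bound (eps : R) : 0 < eps -> exists2 delta : R, 0 < delta &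
  forall es, disjoint_partition x es ->
  (forall e, e \in es -> vnorm e <= delta) ->
  vnorm (\sum_(e <- es) proj e (K e)) <= eps.
Proof.
move=> eps0.
(* The summands 1 in the denominators only keep them positive. *)
have C1 : 0 < `|C| + 1 by rewrite ltr_wpDl.
have [Y YP] : exists Y : seq E, forall v, exists2 y, y \in Y &
    vnorm (K v - vnorm v *: y) <= eps / 2 / (`|C| + 1) * vnorm v.
  by apply: netK; rewrite !divr_gt0.
have {}YP v : exists y, y \in Y /\
    vnorm (K v - vnorm v *: y) <= eps / 2 / (`|C| + 1) * vnorm v.
  by have [y ? ?] := YP v; exists y.
have [f fP] := boolp.choice YP.
pose y := \sum_(z <- Y) vabs z.
have y0 : 0 <= y by apply: vsum_ge0 => z _; exact: vabs_ge0.
have ny1 : 0 < vnorm y + 1 by rewrite ltr_wpDl ?vnorm_ge0.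
exists (eps / 2 / (vnorm y + 1)); first by rewrite !divr_gt0.
set delta := eps / 2 / (vnorm y + 1) => es pes es_delta.
have delta0 : 0 < delta by rewrite !divr_gt0.
have -> : \sum_(e <- es) proj e (K e) =
    \sum_(e <- es) proj e (K e - vnorm e *: f e) +
    \sum_(e <- es) vnorm e *: proj e (f e).
  rewrite -big_split/=; apply: eq_bigr => e _.
  by rewrite projB projZ subrK.
rewrite (le_trans (vnormD _ _))// [leRHS]splitr lerD//.
  rewrite (le_trans (vnorm_sum _ _ _))//.
  rewrite (@le_trans _ _ (\sum_(e <- es) eps / 2 / (`|C| + 1) * vnorm e))//.
    apply: ler_sum => e _; rewrite (le_trans _ (fP e).2)//.
    apply: le_vnorm; rewrite (le_trans (abs_proj_le _ _))// proj_le ?vabs_ge0//.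
  rewrite -mulr_sumr mulrAC ler_pdivrMr// ler_wpM2l ?divr_ge0 ?(ltW eps0)//.
  by rewrite (le_trans (sum_le pes))// (le_trans (ler_norm _))// lerDl.
have fy e : vabs (f e) <= y.
  rewrite /y (big_rem (f e)) ?(fP e).1//= vlerDl//.
  by apply: vsum_ge0 => z _; exact: vabs_ge0.
apply: (@le_trans _ _ (vnorm (delta *: y))).
  apply: le_vnorm; rewrite [X in _ <= X]vabs_id ?vscaler_ge0 ?(ltW delta0)//.
  apply: le_trans (vabs_sum _ _) _.
  apply: le_trans (vlerZ (ltW delta0) (proj_sum_le pes.1 y0)).
  rewrite scaler_sumr; apply: vsum_le => e ees.
  apply: le_trans (vabsZ _ _) _; rewrite ger0_norm ?vnorm_ge0//.
  apply: (@le_trans _ _ (vnorm e *: proj e y)).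
    apply: vlerZ; first exact: vnorm_ge0.
    by rewrite (le_trans (abs_proj_le _ _))// proj_mono// fy.
  by rewrite vlerZl ?es_delta// proj_ge0.
rewrite vnormZ_ge0 ?(ltW delta0)// /delta mulrAC ler_pdivrMr// ler_wpM2l//.
  by rewrite divr_ge0// ltW.
by rewrite lerDl.
Qed.

Lemma fine_partition_false : 0 <= x -> x != 0 ->
  ~ (forall delta : R, 0 < delta -> exists2 es, disjoint_partition x es &
      forall e, e \in es -> vnorm e <= delta).
Proof.
move=> x0 xn0 fine.
have nx0 : 0 < vnorm x.
  rewrite lt_neqAle vnorm_ge0 andbT eq_sym.
  by apply: contra xn0 => /eqP/vnorm0_eq0 ->.
have kappa0 : 0 < (mu - eta) * vnorm x by rewrite mulr_gt0// subr_gt0.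
have [|delta delta0 small] := @pinch_upper_bound ((mu - eta) * vnorm x / 2).
  by rewrite divr_gt0.
have [es pes es_delta] := fine _ delta0.
have := le_trans (pinch_lower_bound pes x0) (small _ pes es_delta).
lra.
Qed.

End FinePartitions.

(** * Existence of fine partitions *)

Section NormLimits.
Context {R : realType} {E : ocBanachLatticeType R}.
Implicit Types (a u x z : E).

Lemma vnorm_le_eq0 z : (forall e : R, 0 < e -> vnorm z <= e) -> z = 0.
Proof.
move=> ze; apply/vnorm0_eq0/le_anti; rewrite vnorm_ge0 andbT.
by apply/ler_addgt0Pl => e e0; rewrite addr0 ze.
Qed.

Lemma vnorm_limit_ge0 a :
  (forall e : R, 0 < e -> exists2 u, 0 <= u & vnorm (u - a) <= e) -> 0 <= a.
Proof.
move=> ua; rewrite -(vposB a).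
suff -> : vpos (- a) = 0 by rewrite subr0 vpos_ge0.
apply: vnorm_le_eq0 => e /ua[u u0]; apply: le_trans.
rewrite -(vnorm_vabs (u - a)) vnorm_le ?vpos_ge0// vjoin_le vabs_ge0 andbT.
by rewrite (le_trans _ (vabs_ge _))// vlerDr.
Qed.

Lemma vnorm_cauchy_series (u : nat -> E) (C : R) :
  (forall n, \sum_(i < n) vnorm (u i) <= C) ->
  exists s, forall e : R, 0 < e ->
    exists N, forall n, (N <= n)%N -> vnorm (s - \sum_(i < n) u i) <= e.
Proof.
move=> uC; pose v : (normed_space E)^nat := u.
have : cvg (series v @ \oo).
  apply: normed_cvg; apply: nondecreasing_is_cvgn.
    by apply: nondecreasing_series => n _ _; exact: normr_ge0.
  by exists C => _ [n _ <-]; rewrite /normed_series_of seriesEord; exact: uC.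
move=> /cvg_ex[s /cvgrPdist_le sP]; exists s => e /sP[N _ NP].
exists N => n /NP; rewrite seriesEord; exact.
Qed.

End NormLimits.

Section FineExist.
Context {R : realType} {E : ocBanachLatticeType R}.
Variables (x : E) (C : R).
Hypothesis x0 : 0 <= x.
Hypothesis sum_le : forall es, disjoint_partition x es ->
  \sum_(e <- es) vnorm e <= C.
Hypothesis atomless : forall a, component x a -> a != 0 ->
  exists b, [/\ component a b, b != 0 & a - b != 0].
Variable delta : R.
Hypothesis delta0 : 0 < delta.

Let fine (a : E) := exists2 es, disjoint_partition a es &
  forall e, e \in es -> vnorm e <= delta.

Let fine_join a b : component a b -> fine b -> fine (a - b) -> fine a.
Proof.
move=> [_ _ d] [es pes es_delta] [fs pfs fs_delta]; exists (es ++ fs).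
  by have := disjoint_partition_cat d pes pfs; rewrite addrC subrK.
by move=> e; rewrite mem_cat => /orP[/es_delta|/fs_delta].
Qed.

Let partition1 (a : E) : 0 <= a -> disjoint_partition a [:: a].
Proof. by move=> a0; split; rewrite ?big_seq1. Qed.

Let fine_small a : 0 <= a -> vnorm a <= delta -> fine a.
Proof.
by move=> a0 ad; exists [:: a]; [exact: partition1|move=> e; rewrite inE => /eqP ->].
Qed.

(* The components that cannot be cut into pieces of norm at most delta. *)
Let coarse a := component x a /\ ~ fine a.

(* The piece cut off is, up to a factor 2, of the largest norm that leaves a
   coarse component. *)
Let greedy_step a : exists b, coarse a -> [/\ component a b, coarse b &
  forall c, component a c -> coarse c -> vnorm (a - c) <= 2 * vnorm (a - b)].
Proof.
have [[ca na]|] := pselect (coarse a); last by exists a.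
have a0 : 0 <= a by case: ca.
(* The case sup A = 0 is separate: then a itself leaves nothing to gain. *)
pose A := [set vnorm (a - c) | c in [set c | component a c /\ coarse c]].
have A0 : A 0.
  exists a; last by rewrite subrr vnorm0.
  by split; [exact: component_refl|].
have supA : has_sup A.
  split; first by exists 0.
  exists (vnorm a) => _ [c [[c0 cle _] _] <-].
  by rewrite vnorm_le ?vsubr_ge0// vlerBlDr vlerDl.
have supA_ge c : component a c -> coarse c -> vnorm (a - c) <= sup A.
  by move=> cc nc; apply: sup_upper_bound => //; exists c.
have : 0 <= sup A by exact: sup_upper_bound.
rewrite le_eqVlt => /predU1P[sup0|sup_gt0].
  exists a => _; split=> //; first exact: component_refl.
  by move=> c cc nc; rewrite subrr vnorm0 mulr0 sup0 supA_ge.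
have [_ [b [cb nb] <-] b_gt] := sup_adherent (divr_gt0 sup_gt0 (ltr0n R 2)) supA.
exists b => _; split=> // c cc nc; apply: le_trans (supA_ge _ cc nc) _.
move: b_gt; lra.
Qed.

(** Otherwise the greedy procedure yields decreasing coarse components whose
    successive differences are disjoint, hence have summable norms, and the
    components converge in norm to a component l.  It is coarse, since each a n
    differs from l by an element that is eventually small; so it is not 0 and
    splits into two non-zero components.  One of them is coarse, and passing to it
    would cut off a fixed norm at every step, although the greedy choice made the
    norms of all possible cuts tend to 0. *)
Lemma fine_partition_exists : exists2 es, disjoint_partition x es &
  forall e, e \in es -> vnorm e <= delta.
Proof.
apply: contrapT => nx.
have [next nextP] := boolp.choice greedy_step.
pose a n := iter n next x.
have coarse_a n : coarse (a n).
  elim: n => [|n /nextP[]//]; split=> //; exact: component_refl.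
have step n : component (a n) (a n.+1) by have [] := nextP _ (coarse_a n).
have a_ge0 n : 0 <= a n by have [[]] := coarse_a n.
have comp n m : (n <= m)%N -> component (a n) (a m).
  move=> /subnK <-; elim: (m - n)%N => [|k IH]; first exact: component_refl.
  exact: component_trans IH (step _).
pose d n := a n - a n.+1.
have tele n : \sum_(i < n) d i = x - a n.
  elim: n => [|n IH]; first by rewrite big_ord0 subrr.
  by rewrite big_ord_recr /= IH /d addrA subrK.
have d_sum n : \sum_(i < n) vnorm (d i) <= C.
  suff [ds pds <-] : exists2 ds, disjoint_partition (x - a n) ds &
      \sum_(e <- ds) vnorm e = \sum_(i < n) vnorm (d i).
    have [[_ _ dn] _] := coarse_a n.
    have := disjoint_partition_cat (vdisjoint_sym dn) pds (partition1 (a_ge0 n)).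
    rewrite subrK => /sum_le; apply: le_trans.
    by rewrite big_cat big_seq1 lerDl vnorm_ge0.
  elim: n => [|n [ds pds dsE]].
    by exists [::]; [split; rewrite ?big_nil ?subrr|rewrite big_nil big_ord0].
  exists (ds ++ [:: d n]); last by rewrite big_cat big_seq1 big_ord_recr /= dsE.
  have dn : vdisjoint (x - a n) (d n).
    apply/vdisjoint_sym/(component_sub _ (component_compl (step n))).
    by have [] := coarse_a n.
  have [dn0 _ _] := component_compl (step n).
  have := disjoint_partition_cat dn pds (partition1 dn0).
  by rewrite /d addrA subrK.
have [s sP] := vnorm_cauchy_series d_sum.
pose l := x - s.
have a_l e : 0 < e -> exists N, forall n, (N <= n)%N -> vnorm (a n - l) <= e.
  move=> /sP[N NP]; exists N => n /NP; rewrite tele /l.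
  by rewrite !opprB addrCA.
have l_ge0 : 0 <= l.
  apply: vnorm_limit_ge0 => e /a_l[N NP]; exists (a N) => //; exact: NP.
have l_le n : l <= a n.
  rewrite -vsubr_ge0; apply: vnorm_limit_ge0 => e /a_l[N NP].
  exists (a n - a (n + N)%N).
    by rewrite vsubr_ge0; have [] := comp n (n + N)%N (leq_addr _ _).
  rewrite opprB [X in vnorm X]addrC addrA subrK.
  by rewrite -vnormN opprB NP// leq_addl.
have l_comp n : component (a n) l.
  split=> //; apply/vdisjoint_posP => //; first by rewrite vsubr_ge0.
  move=> z z0 zl za; apply: vnorm_le_eq0 => e /a_l[N NP].
  have nm := leq_addr N n; have Nm := leq_addl n N.
  apply: le_trans (NP _ Nm); apply: vnorm_le => //.
  have [_ am_le am_d] := comp _ _ nm.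
  apply: (@vle_disjointD _ _ (a n - a (n + N)%N)) => //; rewrite ?vsubr_ge0//.
    by rewrite addrA subrK.
  by apply: (vdisjoint_lel am_d) => //; exact: le_trans (l_le _).
have l_coarse : ~ fine l.
  move=> fl; have [N NP] := a_l _ delta0; have [_ nN] := coarse_a N; apply: nN.
  apply: (fine_join (l_comp N)) => //; apply: fine_small; last exact: NP.
  by rewrite vsubr_ge0.
have l_neq0 : l != 0.
  by apply: contra_notN l_coarse => /eqP ->; exists [::]; [split; rewrite ?big_nil|].
have [b [cb b_neq0 c_neq0]] := atomless (l_comp 0%N) l_neq0.
(* A coarse component c of l would be a candidate at every step N. *)
have no_coarse c : component l c -> l - c != 0 -> fine c.
  move=> cc lc; apply: contrapT => nc; move/eqP : lc; apply.
  apply: vnorm_le_eq0 => e e0.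
  have [N NP] := a_l (e / 4) (divr_gt0 e0 (ltr0n R 4)).
  have aNc : component (a N) c by exact: component_trans (l_comp N) cc.
  have coarse_c : coarse c by split=> //; exact: component_trans (l_comp 0%N) cc.
  have [_ _ /(_ _ aNc coarse_c)] := nextP _ (coarse_a N).
  have : vnorm (l - c) <= vnorm (a N - c).
    by rewrite vnorm_le ?vlerD2r// vsubr_ge0; case: cc.
  have := vnorm_leD (a N - a N.+1) (l - a N.+1).
  rewrite opprB addrA subrK.
  have := NP _ (leqnn N); have := NP _ (leqnSn N).
  rewrite -(vnormN (a N.+1 - l)) opprB -/(a N.+1).
  move=> h1 h2 h3 h4 h5; rewrite -/(a N.+1) in h5.
  move: h1 h2 h3 h4 h5; lra.
apply: l_coarse; apply: (fine_join cb); first exact: no_coarse.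
apply: no_coarse; first exact: component_compl.
by rewrite subKr.
Qed.

End FineExist.

(** * Distance to compact operators on atomless elements *)

Section EssentialLowerBound.
Context {R : realType} {E : ocBanachLatticeType R}.

Lemma atomless_not_compact (S K : {linear E -> E}) (mu eta : R) (x : E) :
  0 <= eta -> eta < mu -> finite_net K ->
  (forall v, vnorm (S v - K v) <= eta * vnorm v) ->
  (forall e, component x e -> mu *: e <= S e) ->
  0 <= x ->
  (forall a, component x a -> a != 0 ->
    exists b, [/\ component a b, b != 0 & a - b != 0]) ->
  x = 0.
Proof.
move=> eta0 eta_mu netK SK S_ge x0 atomless; apply: contrapT => /eqP xn0.
have mu0 : 0 <= mu by rewrite (le_trans eta0)// ltW.
have [C sum_le] := summable_components eta_mu mu0 netK SK S_ge.
have [] := fine_partition_false eta_mu eta0 netK SK S_ge sum_le x0 xn0.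

by move=> delta; exact: (fine_partition_exists x0 sum_le atomless).
Qed.

(** A non-zero component of an element disjoint from all atoms is itself not an
    atom, so it dominates disjoint u, v <> 0; the band of u separates them. *)
Lemma disjoint_atoms_split (x a : E) :
  disjoint_compl (atomic_part E) x -> component x a -> a != 0 ->
  exists b, [/\ component a b, b != 0 & a - b != 0].
Proof.
move=> dx [a0 ax _] an0; have x0 : 0 <= x by exact: le_trans ax.
have not_atom : ~ is_atom a.
  move=> atom_a; move/eqP : an0; apply; apply: vdisjointxx.
  apply: (vdisjoint_lel _ a0 ax); apply: dx => B _ SB; exact: SB.
have [u [v [u0 ua v0 va [uv un0 vn0]]]] : exists u v : E,
    [/\ 0 <= u, u <= a, 0 <= v, v <= a & [/\ vdisjoint u v, u != 0 & v != 0]].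
  apply: contrapT => h; apply: not_atom; split=> // u v u0 ua v0 va uv.
  apply: contrapT => /not_orP[/eqP un0 /eqP vn0]; apply: h.
  by exists u, v.
exists (proj u a); split.
- exact: proj_component.
- apply: contra_neq un0 => ua0; apply/le_anti; rewrite u0 andbT -ua0.
  by rewrite -{1}(proj_id u) proj_mono.
- apply: contra_neq vn0 => ua0; apply/le_anti; rewrite v0 andbT -ua0.
  have -> : a - proj u a = v + (a - v - proj u (a - v)).
    by rewrite projB (proj_eq0 uv) subr0 addrA [v + _]addrC subrK.
  by rewrite vlerDl// vsubr_ge0 proj_le// vsubr_ge0.
Qed.

End EssentialLowerBound.

(** * Compact operators on the complexification *)

Section ComplexNet.
Context {R : realType} {E : ocBanachLatticeType R}.
Local Notation EC := (complexification E).
Local Notation Re := complex.Re.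
Local Open Scope complex_scope.
Implicit Types (z w : EC).

(** The norm of the complexification is a complex number; this is its value as a
    real number. *)
Definition cnormR z : R := vnorm (cmodulus z).

Lemma cnormRE z : `|z| = (cnormR z)%:C.
Proof. exact: cnormE. Qed.

Lemma cnormR_ge0 z : 0 <= cnormR z.
Proof. exact: vnorm_ge0. Qed.

Lemma cnormRZ (a : R) z : 0 <= a -> cnormR (a%:C *: z) = a * cnormR z.
Proof.
move=> a0; rewrite /cnormR cmodulusZ normc_def /= expr0n/= addr0 sqrtr_sqr.
by rewrite vnormZ normr_id ger0_norm.
Qed.

Lemma cnormR_leD z w : cnormR z <= cnormR (z - w) + cnormR w.
Proof.
rewrite -{1}[z](subrK w) (le_trans _ (vnormD _ _))// vnorm_le ?cmodulus_ge0//.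
exact: cmodulusD.
Qed.

Lemma cnormRN z : cnormR (- z) = cnormR z.
Proof. by have := normrN z; rewrite !cnormRE => /complexI. Qed.

Lemma cnormRB z w : cnormR (z - w) <= cnormR z + cnormR w.
Proof.
have := cnormR_leD (z - w) (- w).
by rewrite opprK subrK cnormRN.
Qed.

Lemma cnormR_eq0 z : cnormR z = 0 -> z = 0.
Proof. by move=> z0; apply/normr0_eq0; rewrite cnormRE z0. Qed.

Lemma cnormR_re z : vnorm z.1 <= cnormR z.
Proof. by rewrite -vnorm_vabs vnorm_le ?vabs_ge0// cmodulus_re. Qed.

Lemma cnormR_real (x : E) : cnormR (x, 0) = vnorm x.
Proof.
apply/le_anti; rewrite (cnormR_re (x, 0)) andbT -(vnorm_vabs x).
rewrite vnorm_le ?cmodulus_ge0// (le_trans (cmodulus_le_abs _))//=.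
by rewrite (vabs_id (lexx 0)) addr0.
Qed.

Lemma op_boundsP (T : EC -> EC) (M : R) : op_bounds T M <->
  0 <= M /\ forall z, cnormR (T z) <= M * cnormR z.
Proof.
by split=> -[M0 TM]; split=> // z; have := TM z; rewrite !cnormRE -rmorphM lecR.
Qed.

Lemma compact_net (K : {linear EC -> EC}) : compact_operator K ->
  forall e : R, 0 < e -> exists Z : seq EC, forall z, exists2 w, w \in Z &
    cnormR (K z - (cnormR z)%:C *: w) <= e * cnormR z.
Proof.
move=> + e e0; rewrite /compact_operator precompactE compact_cover.
have eC0 : 0 < e%:C by rewrite ltcR.
move=> /(_ EC setT (fun w => ball w e%:C)).
case=> [w _|z _|Z _ Zcover].
- exact: ball_open.
- by exists z => //; exact: ballxx.
exists (enum_fset Z) => z.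
have := Zcover (K ((cnormR z)^-1%:C *: z)).
case.
  apply: subset_closure; exists ((cnormR z)^-1%:C *: z) => //=.
  rewrite cnormRE cnormRZ ?invr_ge0 ?cnormR_ge0// (_ : 1 = 1%:C)// lecR.
  by have [->|z0] := eqVneq (cnormR z) 0; rewrite ?mulr0 ?mulVf.
move=> w /= wZ; rewrite -ball_normE /= distrC cnormRE ltcR => Kw; exists w => //.
have [z0|z0] := eqVneq (cnormR z) 0.
  have c0 : cnormR (0 : EC) = 0.
    by have := cnormRE (0 : EC); rewrite normr0 => /complexI.
  by rewrite (cnormR_eq0 z0) linear0 c0 scale0r subrr c0 mulr0.
have -> : K z - (cnormR z)%:C *: w =
    (cnormR z)%:C *: (K ((cnormR z)^-1%:C *: z) - w).
  by rewrite scalerBr -linearZ scalerA -rmorphM mulfV// scale1r.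
by rewrite cnormRZ ?cnormR_ge0// mulrC ler_wpM2r ?cnormR_ge0// ltW.
Qed.

End ComplexNet.

(** * Iterates of Riesz operators *)

Section RieszOperators.
Context {R : realType} {E : ocBanachLatticeType R}.
Local Notation EC := (complexification E).
Local Open Scope complex_scope.

(** It makes the set of distances defining [calkin_norm] non-empty, which its
    infimum needs in order to be approached. *)
Lemma compact_operator0 : compact_operator (\0 : EC -> EC).
Proof.
apply: (@precompact_subset _ _ [set 0]) => [_ [z _ <-]//|].
apply: compact_precompact; first exact: norm_hausdorff.
exact: compact_set1.
Qed.

Lemma compact_bounded (K : {linear EC -> EC}) : compact_operator K ->
  exists2 M : R, 0 <= M & forall z, cnormR (K z) <= M * cnormR z.
Proof.
move=> /compact_net/(_ 1 ltr01)[Z ZP].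
exists (1 + \sum_(w <- Z) cnormR w) => [|z].
  by rewrite addr_ge0// sumr_ge0// => w _; exact: cnormR_ge0.
have [w wZ Kw] := ZP z.
have : cnormR w <= \sum_(u <- Z) cnormR u.
  by rewrite (big_rem w)//= lerDl sumr_ge0// => u _; exact: cnormR_ge0.
move=> /(ler_wpM2l (cnormR_ge0 z)).
have := cnormR_leD (K z) ((cnormR z)%:C *: w).
rewrite cnormRZ ?cnormR_ge0//; move: Kw; lra.
Qed.

Lemma bounded_iter (T : EC -> EC) n : bounded_operator T ->
  bounded_operator (iter n T).
Proof.
move=> [M /op_boundsP[M0 TM]]; exists (M ^+ n); apply/op_boundsP.
split; first exact: exprn_ge0.
elim: n => [|n IH] z; first by rewrite expr0 mul1r.
by rewrite iterS exprS -mulrA (le_trans (TM _))// ler_wpM2l.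
Qed.

(** Boundedness of T and K matters: the infimum of an empty set of bounds would
    be 0 without any estimate. *)
Lemma calkin_norm_lt (T : EC -> EC) (r : R) : bounded_operator T ->
  calkin_norm T < r -> exists2 K : {linear EC -> EC}, compact_operator K &
  exists2 M : R, 0 <= M < r & forall z, cnormR (T z - K z) <= M * cnormR z.
Proof.
move=> [M0 /op_boundsP[M00 TM0]] /inf_lt[|_ [K cK <-] Kr].
  by exists (opnorm (T \- \0)), \0 => //; exact: compact_operator0.
exists K => //; have [M1 M10 KM1] := compact_bounded cK.
have [|M /op_boundsP[Mge0 TM] Mr] := inf_lt _ Kr.
  exists (M0 + M1); apply/op_boundsP; split; first exact: addr_ge0.
  move=> z; rewrite mulrDl (le_trans _ (lerD (TM0 z) (KM1 z)))//.
  exact: cnormRB.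
by exists M; [rewrite Mge0|].
Qed.

Lemma riesz_iterate (T : {linear EC -> EC}) (lam : R) : riesz_operator T ->
  0 < lam -> exists n, calkin_norm (iter n T) < lam ^+ n.
Proof.
move=> [_ Tlim] lam0.
have /cvgrPdist_lt/(_ _ lam0)[N _ NP] := Tlim.
exists N.+1; have := NP N.+1 (leqnSn N).
rewrite /= sub0r normrN ger0_norm ?powR_ge0//.
apply: contraTT; rewrite -!leNgt => le_calkin.
have lamE : lam = (lam ^+ N.+1) `^ N.+1%:R^-1.
  rewrite -powR_mulrn ?(ltW lam0)// -powRrM divff ?pnatr_eq0// powRr1//.
  exact: ltW.
rewrite [leLHS]lamE ge0_ler_powR ?nnegrE ?(le_trans _ le_calkin)//;
  by rewrite ?exprn_ge0 ?(ltW lam0) ?invr_ge0.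
Qed.

Section RealPart.
Variable K : {linear EC -> EC}.

(** The real part of K on real vectors: it inherits from K both the finite nets
    and the distance to a real operator. *)
Definition real_part (v : E) : E := (K (v, 0)).1.

Fact real_part_linear : linear real_part.
Proof.
move=> a u v; rewrite /real_part.
have -> : ((a *: u + v, 0) : EC) = a%:C *: ((u, 0) : EC) + ((v, 0) : EC).
  by congr pair; rewrite /= ?scale0r ?scaler0 ?subr0 ?addr0.
by rewrite linearD linearZ /= scale0r subr0.
Qed.

Definition real_part_lin : {linear E -> E} := linear_of real_part_linear.

Lemma real_part_net : compact_operator K -> finite_net real_part.
Proof.
move=> cK e e0; have [Z ZP] := compact_net cK e0.
exists [seq w.1 | w <- Z] => v; have [w wZ Kw] := ZP (v, 0).
exists w.1; first by apply/mapP; exists w.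
rewrite cnormR_real in Kw; apply: le_trans Kw; apply: le_trans (cnormR_re _).
by rewrite /= scale0r subr0.
Qed.

End RealPart.
End RieszOperators.

(** * The diagonal off the atoms *)

Section DiagonalOffAtoms.
Context {R : realType} {E : ocBanachLatticeType R}.
Variable T : regular_operator E.
Hypothesis T0 : 0 <= T.

Lemma iter_complexify n (z : complexification E) :
  iter n (complexify T) z = (iter n T z.1, iter n T z.2).
Proof. by elim: n => [|n /= ->]; first by case: z. Qed.

Lemma iter_linear n : linear (iter n T).
Proof.
move=> a x y; elim: n => //= n ->.
by rewrite regular_opD regular_opZ.
Qed.

Lemma iter_lower_bound (lam : R) (x : E) n :
  0 <= lam -> lam *: x <= T x -> lam ^+ n *: x <= iter n T x.
Proof.
move=> lam0 Tx; elim: n => [|n IH]; first by rewrite expr0 scale1r.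
have Tmono y z : y <= z -> T y <= T z.
  move: T0 => /regular_leP Tp yz; rewrite -vsubr_ge0 -regular_opB Tp//.
  by rewrite vsubr_ge0.
rewrite iterS; apply: le_trans (Tmono _ _ IH); rewrite regular_opZ exprSr -scalerA.
by rewrite vlerZ ?exprn_ge0.
Qed.

Hypothesis riesz_T : riesz_operator (complexify T).

Lemma diagonal_eq0_off_atoms (x : E) : disjoint_compl (atomic_part E) x ->
  op_diagonal T x = 0.
Proof.
have pos y : 0 <= y -> disjoint_compl (atomic_part E) y -> op_diagonal T y = 0.
  move=> y0 dy; apply: contrapT => /eqP Dy0.
  have [lam lam0 [x' [x'0 x'y /eqP x'n0 D_ge]]] :=
    orthomorphism_lower_bound (op_diagonal_ge0 T0) (op_diagonal_orth T) y0 Dy0.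
  have [n calkin_n] := riesz_iterate riesz_T lam0.
  have [K cK [eta /andP[eta0 eta_lam] TK]] :=
    calkin_norm_lt (bounded_iter n riesz_T.1) calkin_n.
  apply: x'n0.
  apply: (@atomless_not_compact _ _ (linear_of (iter_linear n)) (real_part_lin K)
    (lam ^+ n) eta) => //.
  - exact: real_part_net.
  - move=> v; have := TK (v, 0); rewrite cnormR_real; apply: le_trans.
    by apply: le_trans (cnormR_re _); rewrite iter_complexify.
  - move=> e ce; apply: iter_lower_bound; first exact: ltW.
    apply: le_trans (D_ge _ ce) _.
    by have /regular_leP := op_diagonal_le T0; apply; case: ce.
  - move=> a; apply: disjoint_atoms_split => b Ab.
    by apply: vdisjoint_lel (dy _ Ab) x'0 x'y.
move=> dx.
have pos_dx y : vabs y = vabs x -> op_diagonal T (vpos y) = 0.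
  move=> yx; apply: pos => [|b Ab]; first exact: vpos_ge0.
  apply: (vdisjoint_le (dx _ Ab)) => //.
  by rewrite -yx vabs_id ?vpos_ge0// vpos_le_abs.
by rewrite -(vposB x) regular_opB !pos_dx ?vabsN ?subr0.
Qed.

End DiagonalOffAtoms.

Theorem theorem4p5 (R : realType) (E : ocBanachLatticeType R)
    (T : regular_operator E) :
  0 <= T -> riesz_operator (complexify T) ->
  op_diagonal T = atomic_diagonal T.
Proof.
by move=> T0 rT; apply: band_diagonal_eq => // x; exact: diagonal_eq0_off_atoms.
Qed.
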